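(* Let $X,Y$ be Hilbert spaces, $O\in B(X,Y)$, $N\subset X$ a closed subspace, $H=N^\perp$, and let $W$ be a bounded positive operator on $H$. With the notation of the context, the following are equivalent: (i) there is $C<\infty$ such that $\|W^{1/2}P_Hx\|\le C\|Ox\|$ for every $x\in X$; (ii) $W\le C^2S_N$ for some $C<\infty$; (iii) $\operatorname{ran}W^{1/2}\subset\operatorname{ran}O_N^*$; (iv) there is a unique bounded linear map $D:\overline{\operatorname{ran}O}\to\widehat{\mathcal Q}_{N,W}$ satisfying $D(Ox)=W^{1/2}P_Hx$ for every $x\in X$. Define $\kappa_{N,W}=\sup_{Ox\ne0}\|W^{1/2}P_Hx\|/\|Ox\|$ if $\ker O\subset\ker(W^{1/2}P_H)$ (supremum of the empty set being $0$), and $\kappa_{N,W}=+\infty$ otherwise. When the equivalent conditions hold, $$\kappa_{N,W}=\inf\{C\ge0:W\le C^2S_N\}=\|D\|.$$ For every $\delta>0$, $$\inf_{\widehat D:Y\to\widehat{\mathcal Q}_{N,W}}\ \sup_{x\in X,\ \|e\|\le\delta}\big\|\widehat D(Ox+e)-W^{1/2}P_Hx\big\|=\delta\,\kappa_{N,W},$$ where the infimum is over arbitrary (deterministic, not necessarily linear) maps; if $W=0$ both sides are zero. For $W=I_H$ and $H\ne\{0\}$, these conditions are equivalent to $S_N\ge\mathfrak m^2I_H$ for some $\mathfrak m>0$, and also to $H\subset\operatorname{ran}O^*$. In this case $\kappa_{N,I}=\|S_N^{-1/2}\|$.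
   Context: $P_H$ is the orthogonal projection onto $H$. $Y_N=\overline{O(N)}$ and $P_{Y_N}$ is the orthogonal projection onto it. $O_N=(I-P_{Y_N})O|_H:H\to Y_N^\perp$ and $S_N=O_N^*O_N$, a positive operator on $H$. $\widehat{\mathcal Q}_{N,W}=\overline{\operatorname{ran}W^{1/2}}\subset H$ is the Hilbert completion of the target quotient with seminorm $\|W^{1/2}P_Hx\|$, the class of $x$ being identified with $W^{1/2}P_Hx$. *)

(* Defs.v *)
From HB Require Import structures.
From mathcomp Require Import all_boot all_order all_algebra.
From mathcomp Require Import lra complex.
From mathcomp Require Import all_classical all_reals all_analysis.
Set Implicit Arguments.
Unset Strict Implicit.
Unset Printing Implicit Defensive.
Import Order.TTheory GRing.Theory Num.Theory.
Import numFieldNormedType.Exports.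
Local Open Scope classical_set_scope.
Local Open Scope ring_scope.

Variant scalar_kind := RealScalars | ComplexScalars.

Definition scalar (R : realType) (k : scalar_kind) : numFieldType :=
  match k with RealScalars => R | ComplexScalars => R[i] end.

Section Scalars.
Variables (R : realType) (k : scalar_kind).
Local Notation K := (scalar R k).

Definition conjs : K -> K :=
  match k return scalar R k -> scalar R k with
  | RealScalars => idfun
  | ComplexScalars => @conjc R
  end.

Definition res : K -> R :=
  match k return scalar R k -> R with
  | RealScalars => idfun
  | ComplexScalars => @complex.Re R
  end.

Definition ofreal : R -> K :=
  match k return R -> scalar R k with
  | RealScalars => idfun
  | ComplexScalars => fun x => (x%:C)%C
  end.

Lemma conjs_zmod : zmod_morphism conjs.
Proof. by rewrite /conjs; case: k => // x y; rewrite rmorphB. Qed.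

Lemma conjs_monoid : monoid_morphism conjs.
Proof.
rewrite /conjs; case: k => //.
by split=> [|x y]; rewrite ?rmorph1 ?rmorphM.
Qed.

Lemma conjsK : involutive conjs.
Proof. by rewrite /conjs; case: k => // x; rewrite conjcK. Qed.

HB.instance Definition _ := GRing.isZmodMorphism.Build K K conjs conjs_zmod.
HB.instance Definition _ := GRing.isMonoidMorphism.Build K K conjs conjs_monoid.
HB.instance Definition _ := isInvolutive.Build K conjs conjsK.

Lemma mul_conjs (x : K) : x * conjs x = `|x| ^+ 2.
Proof.
rewrite /conjs; move: x; case: k => /= x; last by rewrite sqr_normc.
by rewrite -[RHS]normrX ger0_norm ?expr2// -expr2 sqr_ge0.
Qed.

Lemma norm_conjs (x : K) : `|conjs x| = `|x|.
Proof. by rewrite /conjs; move: x; case: k => //= x; rewrite normcJ. Qed.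

Lemma res_zmod : zmod_morphism res.
Proof. by rewrite /res; case: k => // -[a b] [c d]. Qed.
HB.instance Definition _ := GRing.isZmodMorphism.Build K R res res_zmod.

Lemma ofreal_zmod : zmod_morphism ofreal.
Proof. by rewrite /ofreal; case: k => // x y; rewrite rmorphB. Qed.

Lemma ofreal_monoid : monoid_morphism ofreal.
Proof.
rewrite /ofreal; case: k => //.
by split=> [|x y]; rewrite ?rmorph1 ?rmorphM.
Qed.
HB.instance Definition _ := GRing.isZmodMorphism.Build R K ofreal ofreal_zmod.
HB.instance Definition _ := GRing.isMonoidMorphism.Build R K ofreal ofreal_monoid.

Lemma le_ofreal : {mono ofreal : x y / x <= y}.
Proof. by rewrite /ofreal; case: k => // x y; rewrite lecR. Qed.

Lemma ofrealK : cancel ofreal res.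
Proof. by rewrite /ofreal /res; case: k. Qed.

Lemma resK (x : K) : 0 <= x -> ofreal (res x) = x.
Proof.
rewrite /ofreal /res; move: x; case: k => //= x x0.
by rewrite RRe_real// ger0_real.
Qed.

Lemma le_res (x y : K) : x <= y -> res x <= res y.
Proof.
rewrite /res; move: x y; case: k => //= x y.
by rewrite lecE => /andP[].
Qed.

Lemma res_ge0 (x : K) : 0 <= x -> 0 <= res x.
Proof. by move=> /le_res; rewrite raddf0. Qed.

Lemma lt_ofreal : {mono ofreal : x y / x < y}.
Proof. exact: leW_mono le_ofreal. Qed.
Lemma res_gt0 (x : K) : 0 < x -> 0 < res x.
Proof. by move=> x0; rewrite -lt_ofreal resK ?ltW// rmorph0. Qed.
Lemma resD (x y : K) : res (x + y) = res x + res y.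
Proof. exact: raddfD. Qed.
Lemma resB (x y : K) : res (x - y) = res x - res y.
Proof. exact: raddfB. Qed.
Lemma resMn (x : K) n : res (x *+ n) = res x *+ n.
Proof. exact: raddfMn. Qed.

End Scalars.
Arguments conjs {R k}.
Arguments res {R k}.
Arguments ofreal {R k}.

Record hilbert (R : realType) (k : scalar_kind) := Hilbert {
  hilbert_sort :> completeNormedModType (scalar R k);
  dotp : {dot hilbert_sort for (@conjs R k)};
  dotp_norm : forall x : hilbert_sort, `|x| ^+ 2 = dotp x x
}.

Section HilbertBasics.
Variables (R : realType) (k : scalar_kind) (V : hilbert R k).
Implicit Types (x y z : V) (a : scalar R k).

(* [`|x|] lives in the scalar field, which may be R[i]; [hnorm] lives in R *)
Definition hnorm x : R := res `|x|.

Lemma dotpC x y : dotp V x y = conjs (dotp V y x).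
Proof. by rewrite [LHS](@hermC _ false conjs) expr0 mul1r. Qed.

Lemma dotpDl x y z : dotp V (x + y) z = dotp V x z + dotp V y z.
Proof. by rewrite linearDl. Qed.
Lemma dotpBl x y z : dotp V (x - y) z = dotp V x z - dotp V y z.
Proof. by rewrite linearBl. Qed.
Lemma dotpZl a x z : dotp V (a *: x) z = a * dotp V x z.
Proof. by rewrite linearZl. Qed.
Lemma dotp0l x : dotp V 0 x = 0.
Proof. by rewrite -(subrr 0) dotpBl subrr. Qed.
Lemma dotpDr x y z : dotp V z (x + y) = dotp V z x + dotp V z y.
Proof. by rewrite dotpC dotpDl rmorphD /= -!dotpC. Qed.
Lemma dotpBr x y z : dotp V z (x - y) = dotp V z x - dotp V z y.
Proof. by rewrite dotpC dotpBl rmorphB /= -!dotpC. Qed.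
Lemma dotpZr a x z : dotp V z (a *: x) = conjs a * dotp V z x.
Proof. by rewrite dotpC dotpZl rmorphM /= -dotpC. Qed.

End HilbertBasics.

Record closed_subspace (R : realType) (k : scalar_kind) (V : hilbert R k) :=
  ClosedSubspace {
    cs_set :> set V;
    cs_submod : submod_closed [in cs_set];
    cs_closed : closed cs_set
  }.

Section SubHilbert.
Variables (R : realType) (k : scalar_kind) (V : hilbert R k).
Variable S : closed_subspace V.

Definition cs_pred : {pred V} := [in cs_set S].

Record subh_sort := SubH { subh_val : V; subh_valP : subh_val \in cs_pred }.
HB.instance Definition _ := [isSub for subh_val].
HB.instance Definition _ := [Choice of subh_sort by <:].

HB.instance Definition _ :=
  GRing.isSubmodClosed.Build (scalar R k) V cs_pred (cs_submod S).
HB.instance Definition _ := [SubChoice_isSubLmodule of subh_sort by <:].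

Lemma subh_normD (x y : subh_sort) : `|val (x + y)| <= `|val x| + `|val y|.
Proof. exact: ler_normD. Qed.
Lemma subh_normZ a (x : subh_sort) : `|val (a *: x)| = `|a| * `|val x|.
Proof. exact: normrZ. Qed.
Lemma subh_norm0 (x : subh_sort) : `|val x| = 0 -> x = 0.
Proof. by move=> /normr0_eq0 x0; apply: val_inj; rewrite x0. Qed.
HB.instance Definition _ :=
  Lmodule_isNormed.Build _ subh_sort subh_normD subh_normZ subh_norm0.

Lemma subh_normE (x : subh_sort) : `|x| = `|val x|.
Proof. by []. Qed.

Lemma subh_complete (F : set_system subh_sort) :
  ProperFilter F -> cauchy F -> cvg F.
Proof.
move=> FF /cauchyP cF.
have FG : ProperFilter (val @ F) by exact: fmap_proper_filter.
have cG : cauchy (val @ F).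
  apply/cauchyP => e e0; have [x Fx] := cF e e0; exists (val x).
  by rewrite -ball_normE; move: Fx; rewrite -ball_normE.
have : cvg (val @ F) by exact: cauchy_cvg.
move=> /cvg_ex[l Fl].
have lS : l \in cs_pred.
  apply/mem_set; apply: (@closed_cvg _ _ _ FF val (cs_set S)) Fl.
    exact: cs_closed.
  by apply: nearW => x; exact/set_mem/subh_valP.
apply/cvg_ex; exists (SubH lS).
by apply/cvgrPdist_lt => e e0; move/cvgrPdist_lt : Fl => /(_ e e0).
Qed.
HB.instance Definition _ := Uniform_isComplete.Build subh_sort subh_complete.

Definition subh_dot (x y : subh_sort) : scalar R k := dotp V (val x) (val y).

Lemma subh_dot_bilinear : bilinear_for *%R (@conjs R k \; *%R) subh_dot.
Proof.
have lin a (x y : subh_sort) : val (a *: x + y) = a *: val x + val y by [].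
split=> u a x y; rewrite /subh_dot lin.
  by rewrite dotpDl dotpZl.
by rewrite dotpDr dotpZr.
Qed.
HB.instance Definition _ :=
  bilinear_isBilinear.Build _ _ _ _ _ _ subh_dot subh_dot_bilinear.

Lemma subh_dot_herm x y : subh_dot x y = (-1) ^+ false * conjs (subh_dot y x).
Proof. by rewrite expr0 mul1r /subh_dot -dotpC. Qed.
HB.instance Definition _ :=
  isHermitianSesquilinear.Build _ _ _ _ subh_dot subh_dot_herm.

Lemma subh_dot_gt0 x : x != 0 -> 0 < subh_dot x x.
Proof. by move=> x0; rewrite /subh_dot -dotp_norm exprn_gt0// normr_gt0. Qed.
HB.instance Definition _ := isDotProduct.Build _ _ subh_dot subh_dot_gt0.

Definition subh : hilbert R k :=
  @Hilbert R k subh_sort subh_dot (fun x => dotp_norm (val x)).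

End SubHilbert.

Section Geometry.
Variables (R : realType) (k : scalar_kind) (V : hilbert R k).
Implicit Types (x y z : V) (A : set V) (S : closed_subspace V).

Lemma norm_sub_proj x y : y != 0 ->
  `|x - (dotp V x y / `|y| ^+ 2) *: y| ^+ 2
  = `|x| ^+ 2 - `|dotp V x y| ^+ 2 / `|y| ^+ 2.
Proof.
move=> y0; set c := dotp V x y; set n := `|y| ^+ 2.
have n0 : n != 0 by rewrite expf_neq0// normr_eq0.
have conjn : conjs n = n by rewrite /n dotp_norm -dotpC.
rewrite dotp_norm dotpBl !dotpBr !dotpZl !dotpZr -!dotp_norm -/c -/n.
rewrite [dotp V y x]dotpC -/c rmorphM fmorphV /= conjn.
rewrite -[`|c| ^+ 2]mul_conjs; set d := conjs c.
by rewrite divfK// subrr subr0 [d / n * c]mulrAC [d * c]mulrC.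
Qed.

Lemma cauchy_schwarz x y : `|dotp V x y| <= `|x| * `|y|.
Proof.
have [->|y0] := eqVneq y 0.
  by rewrite dotpC dotp0l rmorph0 !normr0 mulr0.
have n0 : 0 < `|y| ^+ 2 by rewrite exprn_gt0// normr_gt0.
rewrite -(@ler_pXn2r _ 2)// ?nnegrE ?mulr_ge0//.
by rewrite exprMn -ler_pdivrMr// -subr_ge0 -norm_sub_proj// exprn_ge0.
Qed.

Lemma dotp_continuousl y : continuous (fun x => dotp V x y).
Proof.
move=> x; apply/cvgrPdist_le => e e0.
near=> z.
rewrite -dotpBl (le_trans (cauchy_schwarz _ _))//.
have y1 : 0 < `|y| + 1 by rewrite ltr_wpDl.
apply: (@le_trans _ _ (e / (`|y| + 1) * (`|y| + 1))); last by rewrite divfK ?gt_eqF.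
rewrite ler_pM// ?lerDl//.
near: z; apply: cvgr_dist_le => //.
by rewrite divr_gt0.
Unshelve. all: by end_near. Qed.

Definition orthog A : set V := [set x | forall y, A y -> dotp V x y = 0].

Lemma orthog_submod A : submod_closed [in orthog A].
Proof.
split; first by apply/mem_set => y _; rewrite dotp0l.
move=> a x y /set_mem xA /set_mem yA; apply/mem_set => z Az.
by rewrite dotpDl dotpZl xA// yA// mulr0 addr0.
Qed.

Lemma orthog_closed A : closed (orthog A).
Proof.
rewrite (_ : orthog A = \bigcap_(y in A) (fun x => dotp V x y) @^-1` [set 0]).
  apply: closed_bigI => y _; apply: preimage_closed => [x _|].
    exact: dotp_continuousl.
  exact/accessible_closed_set1/hausdorff_accessible/norm_hausdorff.
by apply/seteqP; split=> x.
Qed.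

Definition orthc A : closed_subspace V :=
  ClosedSubspace (orthog_submod A) (@orthog_closed A).

Lemma closure_submod A : submod_closed [in A] -> submod_closed [in closure A].
Proof.
move=> [/set_mem A0 Alin]; split; first exact/mem_set/subset_closure.
move=> a x y /set_mem clx /set_mem cly; apply/mem_set => B nB.
have cont : a *: z.1 + z.2 @[z --> (x, y)] --> a *: x + y.
  by apply: cvgD; [apply: cvgZl_tmp; exact: cvg_fst|exact: cvg_snd].
have [/= [U1 U2] [/= nU1 nU2] sub] := cont _ nB.
have [x' [Ax' Ux']] := clx _ nU1; have [y' [Ay' Uy']] := cly _ nU2.
exists (a *: x' + y'); split; last exact: (sub (x', y')).
by apply/set_mem/Alin; exact/mem_set.
Qed.

Definition closure_subspace A (Asub : submod_closed [in A]) :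
    closed_subspace V :=
  ClosedSubspace (closure_submod Asub) (@closed_closure _ A).

Lemma parallelogram x y :
  `|x + y| ^+ 2 + `|x - y| ^+ 2 = (`|x| ^+ 2 + `|y| ^+ 2) *+ 2.
Proof.
rewrite !dotp_norm dotpBl !dotpBr dotpDl !dotpDr mulr2n opprB.
rewrite addrACA [X in X + _]addrACA subrr addr0 [dotp V y x + _]addrC.
by rewrite [X in _ + X]addrACA subrr addr0 addrACA.
Qed.

Lemma orth_decomposition S x :
  exists p : subh S, forall s : subh S, dotp V (x - val p) (val s) = 0.
Proof.
pose D (s : subh S) : R := res (`|x - val s| ^+ 2).
have D0 s : 0 <= D s by rewrite res_ge0// exprn_ge0.
pose d := inf (range D).
have hasD : has_inf (range D).
  by split; [exists (D 0), 0|exists 0 => _ [s _ <-]].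
have dD s : d <= D s by apply: ge_inf; [exact: hasD.2|exists s].
pose F := filter_from [set e : R | 0 < e] (fun e => [set s | D s < d + e]).
have FF : ProperFilter F.
  apply: filter_from_proper => [|e e0].
    apply: filter_from_filter; first by exists 1 => /=.
    move=> e1 e2 /= e10 e20; exists (Num.min e1 e2); first by rewrite /= lt_min e10.
    move=> s /= Ds; split; apply: (lt_le_trans Ds).
      by rewrite lerD2l ge_min lexx.
    by rewrite lerD2l ge_min lexx orbT.
  by have [_ [s _ <-] ds] := inf_adherent e0 hasD; exists s.
have close s t e : D s < d + e -> D t < d + e ->
    res (`|val s - val t| ^+ 2) < e *+ 4.
  move=> Ds Dt.
  have mid : (x - val s) + (x - val t) = 2 *: (x - val (2^-1 *: (s + t))).
    have -> : val (2^-1 *: (s + t)) = 2^-1 *: (val s + val t) by [].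
    rewrite scalerBr scalerA divff//.
    by rewrite scale1r scaler_nat mulr2n opprD addrACA.
  have := parallelogram (x - val s) (x - val t).
  have sub : x - val s - (x - val t) = val t - val s.
    by rewrite opprB addrC addrA subrK.
  rewrite sub distrC mid normrZ exprMn normr_nat -natrX mulr_natl.
  move=> /(congr1 res); rewrite resMn !resD -!/(D _) => H.
  by have := dD (2^-1 *: (s + t)); lra.
have cF : cauchy F.
  apply/cauchyP => eps eps0.
  have e0 : 0 < res eps ^+ 2 / 4.
    by rewrite divr_gt0// exprn_gt0// res_gt0.
  have [_ [s _ <-] ds] := inf_adherent e0 hasD.
  exists s; exists (res eps ^+ 2 / 4) => // t /= dt.
  rewrite -ball_normE /= subh_normE.
  rewrite -(@ltr_pXn2r _ 2)// ?nnegrE ?(ltW eps0)//.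
  rewrite -[ltLHS]resK ?exprn_ge0// -[eps]resK ?ltW// -rmorphXn lt_ofreal.
  by have := close _ _ _ ds dt; rewrite -[_ *+ 4]mulr_natr divfK.
have : cvg F by exact: cauchy_cvg.
move=> /cvg_ex[p Fp]; exists p => t.
have [->|t0] := eqVneq t 0.
  by rewrite dotpC dotp0l rmorph0.
have cdot : dotp V (x - val s) (val t) @[s --> F] --> dotp V (x - val p) (val t).
  apply: (@continuous_cvg _ _ _ F _ (fun s => x - val s)
    (fun y => dotp V y (val t)) (x - val p)); first exact: dotp_continuousl.
  apply: cvgB; first exact: cvg_cst.
  have Fp' : id @ F --> p by exact: Fp.
  by apply/cvgrPdist_lt => e e0; move/cvgrPdist_lt : Fp' => /(_ e e0).
have c0 : dotp V (x - val s) (val t) @[s --> F] --> (0 : scalar R k).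
  apply/cvgr0Pnorm_lt => eps eps0.
  have tt0 : 0 < `|val t| ^+ 2 by rewrite exprn_gt0// normr_gt0.
  exists (res (eps ^+ 2 / `|val t| ^+ 2)).
    by rewrite /= res_gt0// divr_gt0// exprn_gt0.
  move=> s /= Ds; set a := dotp V _ _.
  have := dD (s + (a / `|val t| ^+ 2) *: t).
  rewrite /D (_ : x - val _ = x - val s - (a / `|val t| ^+ 2) *: val t); last first.
    by rewrite -addrA -opprD.
  rewrite norm_sub_proj// -/a resB -/(D s) lerBrDr -lerBrDl => le1.
  have : res (`|a| ^+ 2 / `|val t| ^+ 2) < res (eps ^+ 2 / `|val t| ^+ 2).
    by apply: le_lt_trans le1 _; rewrite ltrBlDl.
  rewrite -(@lt_ofreal _ k) !resK ?divr_ge0 ?exprn_ge0 ?(ltW eps0)//.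
  by rewrite ltr_pM2r ?invr_gt0// ltr_pXn2r ?nnegrE ?(ltW eps0).
exact: (cvg_unique _ cdot c0).
Qed.

End Geometry.

Lemma range_submod (R : realType) (k : scalar_kind) (U V : hilbert R k)
  (f : {linear U -> V}) : submod_closed [in range f].
Proof.
split; first by apply/mem_set; exists 0; rewrite ?linear0.
move=> a _ _ /set_mem[x _ <-] /set_mem[y _ <-].
by apply/mem_set; exists (a *: x + y); rewrite ?linearP.
Qed.

Lemma image_submod (R : realType) (k : scalar_kind) (U V : hilbert R k)
  (f : {linear U -> V}) (S : closed_subspace U) : submod_closed [in f @` S].
Proof.
have [/set_mem S0 Slin] := cs_submod S.
split; first by apply/mem_set; exists 0; rewrite ?linear0.
move=> a _ _ /set_mem[x Sx <-] /set_mem[y Sy <-].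
apply/mem_set; exists (a *: x + y); last by rewrite linearP.
by apply/set_mem/Slin; exact/mem_set.
Qed.

Section Projections.
Variables (R : realType) (k : scalar_kind) (V : hilbert R k).
Variable S : closed_subspace V.

Definition proj (x : V) : subh S := projT1 (cid (orth_decomposition S x)).

Lemma projP x (s : subh S) : dotp V (x - val (proj x)) (val s) = 0.
Proof. by rewrite /proj; case: cid. Qed.

Lemma sub_proj_orth x : x - val (proj x) \in cs_pred (orthc S).
Proof.
by apply/mem_set => y Sy; exact: (projP x (@SubH _ _ _ S y (mem_set Sy))).
Qed.

(* [I - P_S], corestricted to the orthogonal complement *)
Definition coproj (x : V) : subh (orthc S) := SubH (sub_proj_orth x).

End Projections.

Section ClosedRange.
Variables (R : realType) (k : scalar_kind) (U V : hilbert R k).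
Variable f : {linear U -> V}.

Definition clos_range : closed_subspace V := closure_subspace (range_submod f).

Lemma mem_clos_range x : f x \in cs_pred clos_range.
Proof. by apply/mem_set/subset_closure; exists x. Qed.

Definition to_clos_range (x : U) : subh clos_range := SubH (mem_clos_range x).

End ClosedRange.

Section Operators.
Variables (R : realType) (k : scalar_kind).

(* a bounded operator satisfying [P], if there is one (0 otherwise) *)
Definition the_bounded (U V : hilbert R k) (P : {linear U -> V} -> Prop) :
    {linear U -> V} :=
  match pselect (exists B : {linear U -> V}, continuous B /\ P B) with
  | left e => projT1 (cid e)
  | right _ => \0
  end.

Definition adjoint (U V : hilbert R k) (A : U -> V) : {linear V -> U} :=
  the_bounded (fun B => forall x y, dotp V (A x) y = dotp U x (B y)).

(* self-adjointness is automatic from the second clause for complex scalars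
   only; note that [0 <= z] in a complex field forces [z] to be real *)
Definition positive_op (U : hilbert R k) (A : U -> U) : Prop :=
  (forall x y, dotp U (A x) y = dotp U x (A y)) /\
  (forall x, 0 <= dotp U (A x) x).

Definition loewner_le (U : hilbert R k) (A B : U -> U) : Prop :=
  positive_op (fun x => B x - A x).

Definition opsqrt (U : hilbert R k) (A : U -> U) : {linear U -> U} :=
  the_bounded (fun B => positive_op B /\ forall x, B (B x) = A x).

Definition opinv (U : hilbert R k) (A : U -> U) : {linear U -> U} :=
  the_bounded (fun B => cancel A B /\ cancel B A).

Definition opnorm (U V : hilbert R k) (A : U -> V) : \bar R :=
  ereal_sup [set (hnorm (A x))%:E | x in [set x | hnorm x <= 1]].

End Operators.

Section Setting.
Variables (R : realType) (k : scalar_kind) (X Y : hilbert R k).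
Variables (O : {linear X -> Y}) (N : closed_subspace X).

Definition Hsp : hilbert R k := subh (orthc N).

Definition P_H : X -> Hsp := proj (orthc N).

Definition Y_N : closed_subspace Y := closure_subspace (image_submod O N).

Definition O_N (h : Hsp) : subh (orthc Y_N) := coproj Y_N (O (val h)).

Definition S_N (h : Hsp) : Hsp := adjoint O_N (O_N h).

Variable W : Hsp -> Hsp.

Definition sqrtWP (x : X) : Hsp := opsqrt W (P_H x).

Definition Qhat : hilbert R k := subh (clos_range (opsqrt W)).

Definition target (x : X) : Qhat := to_clos_range (opsqrt W) (P_H x).

(* the ratios are nonnegative, so adjoining 0 only gives sup of the empty set
   the value 0 *)
Definition kappa : \bar R :=
  if `[< forall x, O x = 0 -> sqrtWP x = 0 >] then
    ereal_sup (0%E |` [set (hnorm (sqrtWP x) / hnorm (O x))%:E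
                      | x in [set x | O x <> 0]])
  else +oo%E.

Definition worst_error (delta : R) (Dh : Y -> Qhat) : \bar R :=
  ereal_sup [set (hnorm (Dh (O xe.1 + xe.2) - target xe.1))%:E
            | xe in [set xe : X * Y | hnorm xe.2 <= delta]].

Definition minimax_error (delta : R) : \bar R :=
  ereal_inf [set worst_error delta Dh | Dh in [set: Y -> Qhat]].

Definition is_decoder (D : {linear subh (clos_range O) -> Qhat}) : Prop :=
  continuous D /\ forall x, D (to_clos_range O x) = target x.

End Setting.

(* Main.v *)
Require Import Defs.
From HB Require Import structures.
From mathcomp Require Import all_boot all_order all_algebra.
From mathcomp Require Import ring lra.
From mathcomp Require Import all_classical all_reals all_analysis.
Set Implicit Arguments.
Unset Strict Implicit.
Unset Printing Implicit Defensive.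
Import Order.TTheory GRing.Theory Num.Theory.
Import numFieldNormedType.Exports.
Import Defs.
Local Open Scope classical_set_scope.
Local Open Scope ring_scope.

(**
Write [B = W^(1/2)], so that [|B h|^2 = <W h, h>], and let [|.|] be the norm.

Three of the conditions are one inequality.  As [N] is a closed subspace,
[x - P_H x] lies in [N], and [|O_N h|] is the infimum of [|O h - O n|] over [n]
in [N].  Hence
[|B (P_H x)| <= C |O x|] for all [x] exactly when [|B h| <= C |O_N h|] for all
[h] in [H] ([bound_iff_O_N]).  The square of the last inequality is
[W <= C^2 S_N] ([dominates_observable]), and Douglas' lemma ([douglas]) turns
its solvability in [C] into an inclusion of ranges.  A decoder is the same
inequality again: [O x |-> B (P_H x)] is well defined and bounded by [C] on
the range of [O], and extends to its closure ([extension]), in only one way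
([eq_on_clos_range]).

The extended reals [kappa], [|D|] and [|S_N^(-1/2)|] are nonnegative, and their
real upper bounds are the admissible constants [C]; this determines them
([eq_ereal_of_ub]).

For the minimax error, the measurement [0] is compatible with both [x] and
[- x] as soon as [|O x| <= delta], so every reconstruction errs by at least
[|B (P_H x)|] on one of them; scaling [x] gives [delta * kappa]
([worst_error_ge]).  Applying the linear decoder after the projection onto the
closed range of [O] attains this value ([minimax_le]).

When [W] is the identity, the inequality says that [S_N] is bounded below, so
that it is invertible ([opinvP]).  With [Q = (S_N^-1)^(1/2)] one has
[Q S_N Q = 1], and [|Q g| <= C |g|] for all [g] becomes
[|u|^2 <= C^2 <S_N u, u>] for all [u] under the substitution [u = Q g]
([bounded_by_sqrt_opinv]).

The Hilbert space theory behind this is developed for real and complex scalars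
at once, the estimates being made on the real numbers [hnorm x] and
[res (dotp V x y)].  Adjoints come from the Riesz representation
([riesz_representation]), Douglas' lemma from the uniform boundedness
principle ([uniform_boundedness]), and square roots from an iteration that
converges in norm ([sqrt_iter_limit]).
*)

(** * Scalars, norms and inner products *)

Section ScalarLemmas.
Variables (R : realType) (k : scalar_kind).
Local Notation K := (scalar R k).
Implicit Types (z : K) (c : R).

Lemma res_conjs z : res (conjs z) = res z.
Proof. by move: z; rewrite /res /conjs; case: k => //= -[]. Qed.

Lemma ofreal_res z : conjs z = z -> ofreal (res z) = z.
Proof.
move: z; rewrite /res /conjs /ofreal; case: k => //= -[a b] [] nb.
by congr (complex.Complex _ _); lra.
Qed.

Lemma conjs_ofreal c : conjs (ofreal c) = ofreal c :> K.
Proof.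
by rewrite /ofreal /conjs; case: k => //=; rewrite oppr0.
Qed.

Lemma res_ofrealM c z : res (ofreal c * z) = c * res z.
Proof.
move: z; rewrite /res /ofreal; case: k => //= -[a b] /=.
by rewrite mul0r subr0.
Qed.

Lemma ge0_ofreal c : (0 <= ofreal c :> K) = (0 <= c).
Proof. by rewrite -[0](@rmorph0 _ _ (@ofreal R k)) le_ofreal. Qed.

Lemma norm_ofreal c : `|ofreal c : K| = ofreal `|c|.
Proof.
case: (lerP 0 c) => [c0|/ltW c0].
  by rewrite (ger0_norm c0) ger0_norm// ge0_ofreal.
rewrite (ler0_norm c0) ler0_norm ?rmorphN//.
by rewrite -[0](@rmorph0 _ _ (@ofreal R k)) le_ofreal.
Qed.

Lemma resM z z' : 0 <= z -> 0 <= z' -> res (z * z') = res z * res z'.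
Proof. by move=> z0 z'0; rewrite -{1}(resK z0) res_ofrealM. Qed.

Lemma res_norm_ge0 z : 0 <= res `|z|.
Proof. by rewrite res_ge0. Qed.

Lemma ge0_res z : conjs z = z -> (0 <= z) = (0 <= res z).
Proof. by move=> zr; rewrite -{1}(ofreal_res zr) ge0_ofreal. Qed.

Lemma normr_res z : `|res z| <= res `|z|.
Proof.
rewrite -(@le_ofreal _ k) resK//; move: z; rewrite /res /ofreal.
case: k => //= -[a b] /=; rewrite complex.normc_def complex.lecR.
by rewrite -sqrtr_sqr ler_sqrt ?addr_ge0 ?sqr_ge0// lerDl sqr_ge0.
Qed.

End ScalarLemmas.

Section NormLemmas.
Variables (R : realType) (k : scalar_kind) (V : hilbert R k).
Implicit Types (x y z : V) (a : scalar R k) (c : R).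

Lemma ofreal_hnorm x : ofreal (hnorm x) = `|x|.
Proof. by rewrite resK. Qed.

Lemma hnorm_ge0 x : 0 <= hnorm x.
Proof. by rewrite /hnorm res_ge0. Qed.

Lemma hnorm0 : hnorm (0 : V) = 0.
Proof. by rewrite /hnorm normr0 raddf0. Qed.

Lemma hnorm_eq0 x : hnorm x = 0 -> x = 0.
Proof. by move=> x0; apply: normr0_eq0; rewrite -ofreal_hnorm x0 rmorph0. Qed.

Lemma hnorm_gt0 x : x != 0 -> 0 < hnorm x.
Proof.
move=> x0; rewrite lt_neqAle hnorm_ge0 andbT eq_sym.
by apply: contra x0 => /eqP/hnorm_eq0 ->.
Qed.

Lemma hnorm_le0 x : hnorm x <= 0 -> x = 0.
Proof. by move=> x0; apply/hnorm_eq0/le_anti; rewrite x0 hnorm_ge0. Qed.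

Lemma hnormN x : hnorm (- x) = hnorm x.
Proof. by rewrite /hnorm normrN. Qed.

Lemma hnormD x y : hnorm (x + y) <= hnorm x + hnorm y.
Proof. by rewrite -raddfD le_res// ler_normD. Qed.

Lemma hnormB x y : hnorm (x - y) <= hnorm x + hnorm y.
Proof. by rewrite -(hnormN y) hnormD. Qed.

Lemma hnormC x y : hnorm (x - y) = hnorm (y - x).
Proof. by rewrite -hnormN opprB. Qed.

Lemma hnorm_tri z x y : hnorm (x - y) <= hnorm (x - z) + hnorm (z - y).
Proof. by have := hnormD (x - z) (z - y); rewrite addrA subrK. Qed.

Lemma hnormZ a x : hnorm (a *: x) = res `|a| * hnorm x.
Proof. by rewrite /hnorm normrZ resM. Qed.

Lemma hnormZr c x : hnorm (ofreal c *: x) = `|c| * hnorm x.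
Proof. by rewrite hnormZ norm_ofreal ofrealK. Qed.

Lemma hnormM2 x : hnorm (x *+ 2) = hnorm x *+ 2.
Proof. by rewrite /hnorm normrMn resMn. Qed.

Lemma hnorm_sqr x : hnorm x ^+ 2 = res (dotp V x x).
Proof. by rewrite -dotp_norm !expr2 resM. Qed.

Lemma res_dotpC x y : res (dotp V x y) = res (dotp V y x).
Proof. by rewrite dotpC res_conjs. Qed.

Lemma dotp0r x : dotp V x 0 = 0.
Proof. by rewrite dotpC dotp0l rmorph0. Qed.

Lemma dotpNl x y : dotp V (- x) y = - dotp V x y.
Proof. by rewrite -[- x]add0r dotpBl dotp0l add0r. Qed.

Lemma res_norm_dotp x y : res `|dotp V x y| <= hnorm x * hnorm y.
Proof. by rewrite -resM// le_res// cauchy_schwarz. Qed.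

Lemma abs_res_dotp x y : `|res (dotp V x y)| <= hnorm x * hnorm y.
Proof. exact: le_trans (normr_res _) (res_norm_dotp _ _). Qed.

Lemma res_dotp_le x y : res (dotp V x y) <= hnorm x * hnorm y.
Proof. exact: le_trans (ler_norm _) (abs_res_dotp _ _). Qed.

Lemma hnorm_sqrB x y :
  hnorm (x - y) ^+ 2 = hnorm x ^+ 2 - res (dotp V x y) *+ 2 + hnorm y ^+ 2.
Proof.
rewrite !hnorm_sqr dotpBl !dotpBr !resB (res_dotpC y x); lra.
Qed.

Lemma hnorm_pythagoras x y : dotp V x y = 0 ->
  hnorm (x + y) ^+ 2 = hnorm x ^+ 2 + hnorm y ^+ 2.
Proof.
move=> xy; rewrite !hnorm_sqr dotpDl !dotpDr !resD (res_dotpC y x) xy raddf0.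
lra.
Qed.

Lemma dotp_inj x y : (forall z, dotp V x z = dotp V y z) -> x = y.
Proof.
move=> xy; apply/subr0_eq/hnorm_eq0/eqP.
by rewrite -sqrf_eq0 hnorm_sqr dotpBl xy subrr raddf0.
Qed.

Lemma hnorm_le_sqr x c : 0 <= c -> (hnorm x <= c) = (hnorm x ^+ 2 <= c ^+ 2).
Proof. by move=> c0; rewrite ler_pXn2r// ?nnegrE ?hnorm_ge0. Qed.

End NormLemmas.

Lemma hnorm_subh (R : realType) (k : scalar_kind) (V : hilbert R k)
  (S : closed_subspace V) (x : subh S) : hnorm x = hnorm (val x).
Proof. by []. Qed.

(** * Bounded and positive operators *)

Definition bounded_by (R : realType) (k : scalar_kind) (U V : hilbert R k)
  (f : U -> V) (C : R) := forall x, hnorm (f x) <= C * hnorm x.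

Lemma le0_of_small (R : realType) (a K : R) :
  (forall e, 0 < e -> a <= K * e) -> a <= 0.
Proof.
move=> aK; have K0 : 0 < `|K| + 1 by rewrite ltr_wpDl.
apply/ler_addgt0Pr => e e0; rewrite add0r.
have := aK (e / (`|K| + 1)) (divr_gt0 e0 K0).
move=> /le_trans -> //; rewrite mulrCA ger_pMr// ler_pdivrMr// mul1r.
by rewrite (le_trans (ler_norm K))// lerDl.
Qed.

Section Boundedness.
Variables (R : realType) (k : scalar_kind) (U V : hilbert R k).

Lemma bounded_by_continuous (f : {linear U -> V}) C :
  bounded_by f C -> continuous f.
Proof.
move=> fC; apply: bounded_linear_continuous.
apply/ex_bound; exists (ofreal `|C|).
near=> x; rewrite /= -ofreal_hnorm le_ofreal (le_trans (fC x))//.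
apply: (@le_trans _ _ (`|C| * hnorm x)).
  by rewrite ler_wpM2r ?hnorm_ge0 ?ler_norm.
rewrite ler_piMr// -(@le_ofreal _ k) ofreal_hnorm rmorph1.
by near: x; apply/nbhs_norm0P; exists 1 => //= x /ltW.
Unshelve. all: by end_near. Qed.

Lemma continuous_bounded_by (f : {linear U -> V}) :
  continuous f -> exists2 C, 0 < C & bounded_by f C.
Proof.
move=> /linear_bounded_continuous/linear_boundedP/pinfty_ex_gt0[M M0 fM].
exists (res M); first exact: res_gt0.
move=> x; rewrite /hnorm -resM//; last exact: ltW.
exact: le_res (fM x).
Qed.

End Boundedness.

Section PositiveOperators.
Variables (R : realType) (k : scalar_kind) (V : hilbert R k).

Definition selfadjoint (A : V -> V) :=
  forall x y, dotp V (A x) y = dotp V x (A y).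

(** Self-adjointness makes [<A x, x>] real, so that positivity can be tested on
    real parts. *)
Lemma positive_opP (A : V -> V) : selfadjoint A ->
  positive_op A <-> forall x, 0 <= res (dotp V (A x) x).
Proof.
move=> sA; have eqA x : (0 <= dotp V (A x) x) = (0 <= res (dotp V (A x) x)).
  by apply: ge0_res; rewrite -dotpC -sA.
by split=> [[_ pA] x|pA]; [rewrite -eqA|split=> // x; rewrite eqA].
Qed.

Lemma positive_op_res (A : V -> V) x : positive_op A ->
  0 <= res (dotp V (A x) x).
Proof. by move=> [_ pA]; exact: res_ge0. Qed.

Lemma selfadjointB (A B : V -> V) :
  selfadjoint A -> selfadjoint B -> selfadjoint (fun x => A x - B x).
Proof. by move=> sA sB x y; rewrite dotpBl dotpBr sA sB. Qed.

Lemma selfadjointZ c (A : V -> V) :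
  selfadjoint A -> selfadjoint (fun x => ofreal c *: A x).
Proof. by move=> sA x y; rewrite dotpZl dotpZr sA conjs_ofreal. Qed.

Lemma loewner_leP (A B : V -> V) : selfadjoint A -> selfadjoint B ->
  loewner_le A B <-> forall x, res (dotp V (A x) x) <= res (dotp V (B x) x).
Proof.
move=> sA sB; rewrite /loewner_le (positive_opP (selfadjointB sB sA)).
by split=> AB x; move: (AB x); rewrite dotpBl resB subr_ge0.
Qed.

End PositiveOperators.

(** * Completeness, and extension to the closure of a range *)

Definition lin_pack (R : pzRingType) (U V : lmodType R) (f : U -> V)
  (lf : linear f) : {linear U -> V} :=
  HB.pack f (GRing.isLinear.Build _ _ _ _ _ lf).

Section Completeness.
Variables (R : realType) (k : scalar_kind) (V : hilbert R k).

(** The increments of a bounded real sequence are summable, hence so are the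
    steps of [x].  This form of completeness also gives the rate of convergence,
    and it is applied to extensions by density, to the uniform boundedness
    principle and to square roots. *)
Lemma telescoping_limit (x : nat -> V) (q : nat -> R) M :
  (forall n, hnorm (x n.+1 - x n) <= q n.+1 - q n) -> (forall n, q n <= M) ->
  exists l, forall n, hnorm (l - x n) <= M - q n.
Proof.
move=> xq qM.
have xB n d : hnorm (x (n + d)%N - x n) <= q (n + d)%N - q n.
  elim: d => [|d IH]; first by rewrite addn0 !subrr hnorm0.
  rewrite addnS; apply: le_trans (hnorm_tri (x (n + d)%N) _ _) _.
  by have := xq (n + d)%N; lra.
have hasq : has_sup (range q).
  by split; [exists (q 0%N), 0%N|exists M => _ [n _ <-]].
have : cvg (x @ \oo).
  apply: cauchy_cvg; apply/cauchyP => e e0.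
  have [_ [n _ <-] qn] := sup_adherent (res_gt0 e0) hasq.
  exists (x n); exists n => // m /= /subnKC <-.
  rewrite -ball_normE /= -ofreal_hnorm -[e]resK ?ltW// lt_ofreal hnormC.
  apply: le_lt_trans (xB _ _) _.
  have : q (n + (m - n))%N <= sup (range q).
    by apply: ub_le_sup; [exact: hasq.2|exists (n + (m - n))%N].
  by lra.
move=> /cvg_ex[l xl]; exists l => n.
apply/ler_addgt0Pr => e e0.
have e0' : 0 < ofreal e :> scalar R k by rewrite -(rmorph0 ofreal) lt_ofreal.
have [N _ xN] : \forall m \near \oo, `|l - x m| < ofreal e.
  by move/cvgrPdist_lt : xl; apply.
have /xN : (N <= n + N)%N by rewrite leq_addl.
rewrite -ofreal_hnorm lt_ofreal => /ltW lN.
apply: le_trans (hnorm_tri (x (n + N)%N) _ _) _.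
by have := xB n N; have := qM (n + N)%N; lra.
Qed.

Lemma closure_hnorm (A : set V) x : closure A x ->
  forall e : R, 0 < e -> exists2 y, A y & hnorm (x - y) < e.
Proof.
move=> clx e e0.
have e0' : 0 < ofreal e :> scalar R k by rewrite -(rmorph0 ofreal) lt_ofreal.
have [y [Ay]] := clx _ (nbhsx_ballx x _ e0').
by rewrite -ball_normE /= -ofreal_hnorm lt_ofreal; exists y.
Qed.

Lemma half_expn_small (e : R) : 0 < e -> exists n, 2^-1 ^+ n < e :> R.
Proof.
move=> e0; have := @cvg_geometric R 1 (2^-1).
rewrite ger0_norm ?invr_ge0// invf_lt1// ltr1n => /(_ isT)/cvgrPdist_lt.
move=> /(_ _ e0)[n _ /(_ n (leqnn n))] /=.
rewrite /geometric /= mul1r sub0r normrN ger0_norm ?exprn_ge0 ?invr_ge0//.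
by exists n.
Qed.

End Completeness.

Section Extension.
Variables (R : realType) (k : scalar_kind) (X Y Z : hilbert R k).
Variables (A : {linear X -> Y}).

Lemma clos_range_dense (u : subh (clos_range A)) (e : R) : 0 < e ->
  exists x, hnorm (u - to_clos_range A x) < e.
Proof.
move=> e0; have /set_mem /closure_hnorm := valP u.
by move=> /(_ _ e0)[_ [x _ <-] ux]; exists x.
Qed.

Variables (T : {linear X -> Z}) (C : R).
Hypotheses (C0 : 0 <= C) (TA : forall x, hnorm (T x) <= C * hnorm (A x)).

Let extends (u : subh (clos_range A)) (l : Z) :=
  forall x, hnorm (l - T x) <= C * hnorm (u - to_clos_range A x).

Let extends_ex u : exists l, extends u l.
Proof.
pose r n : R := 2^-1 ^+ n.
have r0 n : 0 < r n by rewrite exprn_gt0// invr_gt0.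
have rS n : r n = r n.+1 *+ 2 by rewrite /r exprS; lra.
have [x xu] := choice (fun n => clos_range_dense u (r0 n)).
have TB y z : hnorm (T y - T z) <= C * hnorm (A y - A z).
  by rewrite -!linearB.
(* [T x_n] moves by at most [3 C r_(n+1)], while the majorant [- 4 C r_n]
   increases by [4 C r_(n+1)] *)
have [n|n|l lx] := @telescoping_limit _ _ _ (T \o x)
    (fun n => - (C * r n) *+ 4) 0.
- apply: le_trans (TB _ _) _.
  have : hnorm (A (x n.+1) - A (x n)) <= r n + r n.+1.
    apply: le_trans (hnorm_tri (val u) _ _) _.
    have := xu n; have := xu n.+1; rewrite hnormC !hnorm_subh /= => *; lra.
  move=> /(ler_wpM2l C0) /le_trans; apply.
  have := r0 n.+1; rewrite (rS n) => /ltW /(mulr_ge0 C0); lra.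
- by rewrite mulNrn oppr_le0 mulrn_wge0// mulr_ge0// ltW.
exists l => y; rewrite -subr_le0; apply: (@le0_of_small _ _ (C *+ 5)) => e e0.
have [n ne] := half_expn_small e0.
have l1 := lx n; have l2 := hnorm_tri (T (x n)) l (T y).
have l3 : hnorm (T (x n) - T y)
    <= C * (r n + hnorm (u - to_clos_range A y)).
  apply: le_trans (TB _ _) _; rewrite ler_wpM2l//.
  apply: le_trans (hnorm_tri (val u) _ _) _.
  by rewrite lerD2r hnormC; exact: ltW (xu n).
have : C * r n <= C * e by rewrite ler_wpM2l// ltW.
by move: l1 => /=; move: l3; rewrite mulrDr => *; lra.
Qed.

Let D u := projT1 (cid (extends_ex u)).
Let DP u : extends u (D u). Proof. by rewrite /D; case: cid. Qed.

Let D_linear : linear D.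
Proof.
move=> a u v; apply/subr0_eq/hnorm_le0.
apply: (@le0_of_small _ _ (C * (res `|a| + 1) *+ 2)) => e e0.
have [x xu] := clos_range_dense u e0; have [y yv] := clos_range_dense v e0.
have bound (s t : subh (clos_range A)) :
    hnorm (a *: s + t) <= res `|a| * hnorm s + hnorm t.
  by rewrite -hnormZ hnormD.
have boundZ (s t : Z) : hnorm (a *: s + t) <= res `|a| * hnorm s + hnorm t.
  by rewrite -hnormZ hnormD.
have a0 := res_norm_ge0 a.
have ae : res `|a| * hnorm (u - to_clos_range A x) <= res `|a| * e.
  by rewrite ler_wpM2l// ltW.
have := DP (a *: u + v) (a *: x + y).
have -> : a *: u + v - to_clos_range A (a *: x + y)
    = a *: (u - to_clos_range A x) + (v - to_clos_range A y).
  apply: val_inj; rewrite /= linearP /= scalerBr opprD.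
  by rewrite addrACA.
move=> l1.
have {}l1 : hnorm (D (a *: u + v) - T (a *: x + y)) <= C * ((res `|a| + 1) * e).
  apply: le_trans l1 _; rewrite ler_wpM2l//; apply: le_trans (bound _ _) _.
  by rewrite mulrDl mul1r lerD// ltW.
have l2 : hnorm (T (a *: x + y) - (a *: D u + D v)) <= C * ((res `|a| + 1) * e).
  rewrite hnormC.
  have -> : a *: D u + D v - T (a *: x + y) = a *: (D u - T x) + (D v - T y).
    by rewrite linearP scalerBr opprD addrACA.
  apply: le_trans (boundZ _ _) _.
  rewrite mulrDl mul1r mulrDr lerD//.
    rewrite mulrCA ler_wpM2l//; apply: le_trans (DP _ x) _.
    by rewrite ler_wpM2l// ltW.
  by apply: le_trans (DP _ y) _; rewrite ler_wpM2l// ltW.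
apply: le_trans (hnorm_tri (T (a *: x + y)) _ _) _.
by move: l1 l2; rewrite mulrnAl !mulrA => *; lra.
Qed.

(** The value at [u] is the only point within [C |u - A x|] of [T x] for every
    [x]: it is the limit of [T x_n] along any [A x_n] converging to [u], and
    linearity and the bound are read off from this characterization. *)
Lemma extension : exists D : {linear subh (clos_range A) -> Z},
  (forall x, D (to_clos_range A x) = T x) /\ bounded_by D C.
Proof.
exists (lin_pack D_linear); split=> [x|u] /=.
  apply/subr0_eq/hnorm_le0; apply: le_trans (DP _ x) _.
  by rewrite subrr hnorm0 mulr0.
by have := DP u 0; rewrite linear0 subr0 hnorm_subh /= linear0 subr0.
Qed.

End Extension.

(** * Projections, adjoints and Douglas' lemma *)

Section Projection.
Variables (R : realType) (k : scalar_kind) (V : hilbert R k).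
Variable S : closed_subspace V.

Lemma proj_unique x (p : subh S) :
  (forall s : subh S, dotp V (x - val p) (val s) = 0) -> proj S x = p.
Proof.
move=> xp; apply/subr0_eq/hnorm_eq0/eqP; rewrite -sqrf_eq0 hnorm_sqr.
have := xp (proj S x - p); have := projP x (proj S x - p).
move=> /(congr1 (fun z => - z)); rewrite -dotpNl opprB oppr0 => e1 e2.
have : dotp V (val (proj S x) - x + (x - val p)) (val (proj S x - p)) = 0.
  by rewrite dotpDl e1 e2 addr0.
by rewrite addrA subrK => e; rewrite (congr1 res e) raddf0.
Qed.

Lemma proj_linear : linear (proj S).
Proof.
move=> a x y; apply: proj_unique => s /=.
rewrite opprD addrACA -scalerBr dotpDl dotpZl.
by rewrite !projP mulr0 addr0.
Qed.
HB.instance Definition _ :=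
  GRing.isLinear.Build _ _ _ _ (proj S) proj_linear.

Lemma coproj_linear : linear (coproj S).
Proof.
move=> a x y; apply: val_inj => /=.
by rewrite linearP /= opprD addrACA scalerBr.
Qed.
HB.instance Definition _ :=
  GRing.isLinear.Build _ _ _ _ (coproj S) coproj_linear.

Lemma dotp_proj x (s : subh S) :
  dotp (subh S) (proj S x) s = dotp V x (val s).
Proof. by apply/esym/subr0_eq; rewrite -dotpBl projP. Qed.

Lemma proj_val (s : subh S) : proj S (val s) = s.
Proof. by apply: proj_unique => t; rewrite subrr dotp0l. Qed.

Lemma hnorm_proj_coproj x :
  hnorm x ^+ 2 = hnorm (coproj S x) ^+ 2 + hnorm (proj S x) ^+ 2.
Proof. by rewrite -{1}(subrK (val (proj S x)) x) hnorm_pythagoras ?projP. Qed.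

Lemma hnorm_proj_le x : hnorm (proj S x) <= hnorm x.
Proof.
by rewrite hnorm_le_sqr ?hnorm_ge0// hnorm_proj_coproj lerDr sqr_ge0.
Qed.

(** The coprojection realizes the distance to [S]. *)
Lemma hnorm_coproj_le_dist x s : cs_set S s ->
  hnorm (coproj S x) <= hnorm (x - s).
Proof.
move=> Ss; rewrite hnorm_le_sqr ?hnorm_ge0//.
have -> : x - s = val (coproj S x) + val (proj S x - SubH (mem_set Ss)).
  by rewrite /= addrA subrK.
by rewrite hnorm_pythagoras ?projP// lerDl sqr_ge0.
Qed.

Lemma hnorm_coproj_le x : hnorm (coproj S x) <= hnorm x.
Proof.
have [/set_mem S0 _] := cs_submod S.
by have := hnorm_coproj_le_dist x S0; rewrite subr0.
Qed.

Lemma coproj_eq0 s : cs_set S s -> coproj S s = 0.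
Proof.
by move=> /hnorm_coproj_le_dist => /(_ s); rewrite subrr hnorm0 => /hnorm_le0.
Qed.

End Projection.

(** This contains the double orthogonal theorem: the part of [x] orthogonal to
    the orthogonal of [S] is [proj S x], which lies in [S]. *)
Lemma proj_orthc (R : realType) (k : scalar_kind) (V : hilbert R k)
  (S : closed_subspace V) x : proj (orthc S) x = coproj S x.
Proof.
apply: proj_unique => s /=; rewrite opprB addrC subrK dotpC.
by rewrite (set_mem (valP s)) ?rmorph0//; exact/set_mem/valP.
Qed.

Section Adjoint.
Variables (R : realType) (k : scalar_kind).
Local Notation K := (scalar R k).

(** A nonzero functional is determined by its kernel and its value at one
    vector [z] orthogonal to it, so it is a multiple of [<_, z>]. *)
Lemma riesz_representation (V : hilbert R k) (f : V -> K) (C : R) :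
  (forall a x y, f (a *: x + y) = a * f x + f y) ->
  (forall x, res `|f x| <= C * hnorm x) ->
  exists v, forall x, f x = dotp V x v.
Proof.
move=> flin fC.
have f0 : f 0 = 0 by have := flin (-1) 0 0; rewrite scaler0 addr0 mulN1r addNr.
have fZ a x : f (a *: x) = a * f x by rewrite -[a *: x]addr0 flin f0 addr0.
have fB x y : f (x - y) = f x - f y.
  by rewrite addrC -scaleN1r flin mulN1r addrC.
have Ssub : submod_closed [in [set x | f x = 0]].
  split; first by rewrite inE.
  by move=> a x y; rewrite !inE /= flin => -> ->; rewrite mulr0 addr0.
have Sclosed : closed [set x | f x = 0].
  move=> x clx /=; apply/normr0_eq0.
  rewrite -[LHS]resK// -[RHS](rmorph0 ofreal); congr ofreal.
  apply: le_anti; rewrite res_norm_ge0 andbT.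
  apply: (@le0_of_small _ _ `|C|) => e e0.
  have [y /= fy xy] := closure_hnorm clx e0.
  have := fC (x - y); rewrite fB fy subr0 => /le_trans; apply.
  apply: (@le_trans _ _ (`|C| * hnorm (x - y))).
    by rewrite ler_wpM2r ?hnorm_ge0 ?ler_norm.
  by rewrite ler_wpM2l// ltW.
pose S := ClosedSubspace Ssub Sclosed.
have [all0|/existsNP[x0 fx0]] := pselect (forall x, f x = 0).
  by exists 0 => x; rewrite dotp0r.
pose z := x0 - val (proj S x0).
have fz : f z = f x0 by rewrite fB (set_mem (valP (proj S x0))) subr0.
have fz0 : f z != 0 by rewrite fz; apply/eqP.
have z0 : dotp V z z != 0.
  rewrite -dotp_norm expf_neq0// normr_eq0; apply: contraNneq fz0 => ->.
  by rewrite f0.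
exists (conjs (f z / dotp V z z) *: z) => x; rewrite dotpZr conjsK.
have Sx : cs_set S (x - (f x / f z) *: z).
  by rewrite /= fB fZ divfK// subrr.
have : dotp V z (x - (f x / f z) *: z) = 0.
  exact: (projP x0 (SubH (mem_set Sx))).
rewrite dotpC dotpBl dotpZl => /(congr1 conjs); rewrite conjsK rmorph0.
move=> /subr0_eq ->.
by rewrite [RHS]mulrC -[RHS]mulrA [dotp V z z * _]mulrC !divfK.
Qed.

Lemma the_boundedP (U V : hilbert R k) (P : {linear U -> V} -> Prop) :
  (exists B : {linear U -> V}, continuous B /\ P B) ->
  continuous (the_bounded P) /\ P (the_bounded P).
Proof.
by rewrite /the_bounded; case: pselect => // e _; case: cid.
Qed.

(** The representing vector [B y] of [x |-> <A x, y>] is bounded by [C |y|]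
    because [|B y|^2 = <A (B y), y> <= C |B y| |y|]. *)
Lemma adjointP (U V : hilbert R k) (A : {linear U -> V}) : continuous A ->
  continuous (adjoint A) /\
  forall x y, dotp V (A x) y = dotp U x (adjoint A y).
Proof.
move=> /continuous_bounded_by[C C0 AC].
apply: (@the_boundedP _ _
  (fun B => forall x y, dotp V (A x) y = dotp U x (B y))).
have AV y x : res `|dotp V (A x) y| <= (C * hnorm y) * hnorm x.
  rewrite mulrAC; apply: le_trans (res_norm_dotp _ _) _.
  by rewrite ler_wpM2r ?hnorm_ge0.
have ex y : exists v, forall x, dotp V (A x) y = dotp U x v.
  apply: riesz_representation (AV y) => a x x'.
  by rewrite linearP dotpDl dotpZl.
have [B BP] := choice ex.
have Blin : linear B.
  move=> a y y'; apply: dotp_inj => x; rewrite dotpC [RHS]dotpC.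
  congr (conjs _).
  by rewrite dotpDr dotpZr -!BP dotpDr dotpZr.
exists (lin_pack Blin); split=> //.
apply: (@bounded_by_continuous _ _ _ _ _ C) => y /=.
have [->|By0] := eqVneq (B y) 0.
  by rewrite hnorm0 mulr_ge0// ?hnorm_ge0 ?ltW.
have By := hnorm_gt0 By0; rewrite -(ler_pM2r By) -expr2 hnorm_sqr -BP.
apply: le_trans (res_dotp_le _ _) _; rewrite mulrAC.
by rewrite ler_wpM2r ?hnorm_ge0.
Qed.

End Adjoint.

Section UniformBoundedness.
Variables (R : realType) (k : scalar_kind) (V : hilbert R k).

(** Gliding hump: if the norms were unbounded, choose [v_n] in [F] growing
    faster than [n 3^n] and build [x_(n+1)] from [x_n] by a step of length
    [3^-(n+1)] along [v_n], with the sign that does not cancel [<v_n, x_n>].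
    All later steps add up to at most half of that length, so [<v_n, _>] stays
    large at the limit, against pointwise boundedness. *)
Lemma uniform_boundedness (F : set V) :
  (forall h, exists M, forall v, F v -> `|res (dotp V v h)| <= M) ->
  exists C, forall v, F v -> hnorm v <= C.
Proof.
move=> Fb; apply: contrapT => /forallNP nC.
pose r n : R := 3^-1 ^+ n.
have r0 n : 0 < r n by rewrite exprn_gt0// invr_gt0.
have rS n : r n = 3 * r n.+1 by rewrite /r exprS; lra.
have /choice[v vP] n : exists v, F v /\ n%:R * 2 / r n.+1 < hnorm v.
  by have /existsNP[v /not_implyP[Fv /negP]] := nC (n%:R * 2 / r n.+1);
    rewrite -ltNge; exists v.
have v0 n : 0 < hnorm (v n).
  by apply: le_lt_trans (vP n).2; rewrite divr_ge0 ?mulr_ge0// ltW.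
pose s n y : R := if 0 <= res (dotp V (v n) y) then 1 else -1.
have s1 n y : `|s n y| = 1 by rewrite /s; case: ifP; rewrite ?normrN normr1.
pose step n y := y + ofreal (s n y * (r n.+1 / hnorm (v n))) *: v n.
pose x := fix x n := if n is m.+1 then step m (x m) else 0.
have xS n : x n.+1 = step n (x n) by [].
have [n|n|l lx] := @telescoping_limit _ _ _ x (fun n => - (r n / 2)) 0.
- rewrite xS /step addrC addKr hnormZr normrM s1 mul1r ger0_norm.
    by rewrite divfK ?gt_eqF// (rS n); lra.
  by rewrite divr_ge0// ltW.
- by rewrite oppr_le0 divr_ge0// ltW.
have large n : n%:R < `|res (dotp V (v n) l)|.
  have : r n.+1 * hnorm (v n) <= `|res (dotp V (v n) (x n.+1))|.
    rewrite xS /step dotpDr dotpZr conjs_ofreal resD res_ofrealM -hnorm_sqr.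
    have -> : s n (x n) * (r n.+1 / hnorm (v n)) * hnorm (v n) ^+ 2
        = s n (x n) * (r n.+1 * hnorm (v n)).
      by rewrite expr2 !mulrA divfK// gt_eqF.
    have rv : 0 <= r n.+1 * hnorm (v n) by rewrite mulr_ge0// ltW.
    rewrite /s; case: ifPn => [p|]; last rewrite -ltNge => p.
      by rewrite mul1r ger0_norm ?lerDr// addr_ge0.
    by rewrite mulN1r ltr0_norm; lra.
  have : `|res (dotp V (v n) (l - x n.+1))| <= hnorm (v n) * (r n.+1 / 2).
    apply: le_trans (abs_res_dotp _ _) _.
    by rewrite ler_wpM2l ?hnorm_ge0//; have := lx n.+1; rewrite sub0r opprK.
  rewrite dotpBr resB => b1 b2.
  have := lerB_dist (res (dotp V (v n) (x n.+1))) (res (dotp V (v n) l)).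
  rewrite [X in _ <= X]distrC => b3.
  have := (vP n).2; rewrite ltr_pdivrMr// => b4.
  by move: b1 b2 b3 b4; set a := r n.+1; set b := hnorm (v n); nra.
have [M MP] := Fb l.
have := MP _ (vP (Num.truncn M).+1).1; apply/negP; rewrite -ltNge.
by apply: lt_trans (large _); exact: Num.Theory.truncnS_gt.
Qed.

End UniformBoundedness.

Section Douglas.
Variables (R : realType) (k : scalar_kind) (X Y Z : hilbert R k).

(** If [|T x| <= C |A x|], then [T = D A] with [D] bounded on the closed range
    of [A], whence [T^* = A^* D^*].  Conversely, if every [T^* z] is some
    [A^* y], then [|<T x, z>| <= |y| |A x|], so the vectors [T x / |A x|] are
    bounded in every direction [z], and the uniform boundedness principle
    applies. *)
Lemma douglas (A : {linear X -> Y}) (T : {linear X -> Z}) (Ts : Z -> X) :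
  continuous A -> (forall x z, dotp Z (T x) z = dotp X x (Ts z)) ->
  (exists C, forall x, hnorm (T x) <= C * hnorm (A x)) <->
  range Ts `<=` range (adjoint A).
Proof.
move=> Ac TsP; have [_ AP] := adjointP Ac; split.
  move=> [C TC] _ [z _ <-].
  have TC' x : hnorm (T x) <= `|C| * hnorm (A x).
    by apply: le_trans (TC x) _; rewrite ler_wpM2r ?hnorm_ge0 ?ler_norm.
  have [D [DA /bounded_by_continuous Dc]] := extension (normr_ge0 C) TC'.
  have [_ DP] := adjointP Dc.
  exists (val (adjoint D z)) => //; apply: dotp_inj => x.
  by rewrite dotpC -AP [RHS]dotpC -TsP -DA DP.
move=> ran.
have AT z : exists y, forall x, dotp Z (T x) z = dotp Y (A x) y.
  have [|y _ yz] := ran (Ts z); first by exists z.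
  by exists y => x; rewrite TsP -yz AP.
pose F := [set v | exists2 x, A x != 0 & v = ofreal (hnorm (A x))^-1 *: T x].
have [z|C CP] := @uniform_boundedness _ _ _ F.
  have [y yP] := AT z; exists (hnorm y) => _ [x Ax0 ->].
  have Ax := hnorm_gt0 Ax0.
  rewrite dotpZl res_ofrealM normrM yP ger0_norm ?invr_ge0 ?hnorm_ge0//.
  by rewrite mulrC ler_pdivrMr// mulrC abs_res_dotp.
exists C => x; have [Ax|Ax0] := eqVneq (A x) 0.
  have -> : T x = 0.
    apply: dotp_inj => z; have [y ->] := AT z.
    by rewrite Ax !dotp0l.
  by rewrite Ax !hnorm0 mulr0.
have Ax := hnorm_gt0 Ax0.
have /CP : F (ofreal (hnorm (A x))^-1 *: T x) by exists x.
rewrite hnormZr ger0_norm ?invr_ge0 ?hnorm_ge0//.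
by rewrite mulrC ler_pdivrMr.
Qed.

End Douglas.

(** * Square roots of positive operators *)

Section SqrtIteration.
Variable R : realType.

(** The distances to 1 of the numbers [q_0 = 0], [q_(n+1) = (1 + q_n^2) / 2],
    which majorize the operator iteration for the square root. *)
Fixpoint sqrt_gap (n : nat) : R :=
  if n is m.+1 then sqrt_gap m - sqrt_gap m ^+ 2 / 2 else 1.

Lemma sqrt_gap_itv n : 0 <= sqrt_gap n <= 1.
Proof.
elim: n => [|n /andP[g0 g1]] /=; first by rewrite ler01 lexx.
by move: g0 g1; set g := sqrt_gap n => *; apply/andP; split; nra.
Qed.

Lemma sqrt_gap_le n : sqrt_gap n * n.+2%:R <= 2.
Proof.
elim: n => [|n IH] /=; first by rewrite mul1r.
have /andP[] := sqrt_gap_itv n; move: IH; rewrite -[n.+3]add1n natrD.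
set g := sqrt_gap n; set m := n.+2%:R => gm g0 g1.
(* for [g = 2 / m] the next gap is [2 (m - 1) / m^2], at most [2 / (m + 1)];
   smaller gaps [g] are covered by monotonicity, here as an identity *)
have : 0 <= (2 - g * m) * (1 - g / 2) by apply: mulr_ge0; lra.
have := sqr_ge0 g; rewrite expr2.
have -> : (g - g * g / 2) * (1 + m)
    = 2 - (2 - g * m) * (1 - g / 2) - g * g / 2 by field.
lra.
Qed.

Lemma sqrt_gap_small (e : R) : 0 < e -> exists n, sqrt_gap n < e.
Proof.
move=> e0; exists (Num.truncn (2 / e)).
set n := Num.truncn _; have := sqrt_gap_le n.
rewrite -ler_pdivlMr// => /le_lt_trans; apply.
rewrite ltr_pdivrMr// mulrC -ltr_pdivrMr//.
apply: lt_trans (Num.Theory.truncnS_gt _) _.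
by rewrite ltr_nat.
Qed.

Lemma le0_of_sqrt_gap (a K : R) : 0 <= K ->
  (forall n, a <= K * sqrt_gap n) -> a <= 0.
Proof.
move=> K0 aK; apply: (@le0_of_small _ _ K) => e e0.
have [n ne] := sqrt_gap_small e0.
by apply: le_trans (aK n) _; rewrite ler_wpM2l// ltW.
Qed.

End SqrtIteration.

Section SquareRoot.
Variables (R : realType) (k : scalar_kind) (V : hilbert R k).

(** Positivity of [A] at the vector [x - A x] gives [|A x|^2 <= <A x, x>] when
    [|A| <= 1], without the formula for the norm of a self-adjoint operator. *)
Lemma positive_contraction (A : {linear V -> V}) :
  positive_op A -> bounded_by A 1 -> bounded_by (fun x => x - A x) 1.
Proof.
move=> Apos A1 x; rewrite mul1r hnorm_le_sqr ?hnorm_ge0// hnorm_sqrB.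
have sA : selfadjoint A by case: Apos.
have := positive_op_res (x - A x) Apos.
rewrite [A (_ - _)]linearB dotpBl !dotpBr !resB (sA (A x) x) -hnorm_sqr.
move=> pos.
have : res (dotp V (A (A x)) (A x)) <= hnorm (A x) ^+ 2.
  apply: le_trans (res_dotp_le _ _) _; rewrite expr2 ler_wpM2r ?hnorm_ge0//.
  by have := A1 (A x); rewrite mul1r.
have := res_dotpC x (A x); have := sqr_ge0 (hnorm (A x)).
by lra.
Qed.

Section Contraction.
Variables (T : {linear V -> V}).
Hypotheses (sT : selfadjoint T) (T1 : bounded_by T 1).

Let half : scalar R k := ofreal 2^-1.

(** With [T = 1 - A], a solution of [2 Y = T + Y^2] yields the square root
    [1 - Y] of [A]; the iteration solves this fixed point equation.  By
    induction, [Y_n] and [Y_(n+1) - Y_n] have norms at most [q_n] and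
    [q_(n+1) - q_n], where [q_n] is the same iteration for the number 1. *)
Fixpoint sqrt_iter (n : nat) : V -> V :=
  if n is m.+1 then fun x => half *: (T x + sqrt_iter m (sqrt_iter m x))
  else fun=> 0.
Local Notation Y := sqrt_iter.
Local Notation g := (@sqrt_gap R).

Let g0 n : 0 <= g n. Proof. by have /andP[] := sqrt_gap_itv R n. Qed.
Let g1 n : g n <= 1. Proof. by have /andP[] := sqrt_gap_itv R n. Qed.

Let Y_linear n : linear (Y n).
Proof.
elim: n => [|n IH] a x y /=; first by rewrite scaler0 addr0.
rewrite linearP !IH scalerA mulrC -scalerA -scalerDr; congr (_ *: _).
by rewrite scalerDr addrACA.
Qed.

Let YB n x y : Y n (x - y) = Y n x - Y n y.
Proof. by rewrite addrC -scaleN1r Y_linear scaleN1r addrC. Qed.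

Let Y_selfadjoint n : selfadjoint (Y n).
Proof.
elim: n => [|n IH] x y /=; first by rewrite dotp0l dotp0r.
by rewrite dotpZl dotpZr conjs_ofreal dotpDl dotpDr sT !IH.
Qed.

Let Y_bounded n : bounded_by (Y n) (1 - g n).
Proof.
elim: n => [|n IH] x /=; first by rewrite subrr mul0r hnorm0.
rewrite hnormZr ger0_norm ?invr_ge0//.
have YY : hnorm (Y n (Y n x)) <= (1 - g n) * ((1 - g n) * hnorm x).
  by apply: le_trans (IH _) _; rewrite ler_wpM2l// subr_ge0.
have := hnormD (T x) (Y n (Y n x)); have := T1 x; move: YY.
set a := hnorm (T x + _); set b := hnorm x; set c := hnorm _; set d := g n.
by move=> *; nra.
Qed.

Let Y_step n x : hnorm (Y n.+1 x - Y n x) <= (g n - g n.+1) * hnorm x.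
Proof.
elim: n x => [|n IH] x.
  rewrite /= !addr0 subr0 hnormZr ger0_norm ?invr_ge0//.
  by have := T1 x; lra.
have -> : Y n.+2 x - Y n.+1 x = half *: (Y n.+1 (Y n.+1 x - Y n x)
    + (Y n.+1 (Y n x) - Y n (Y n x))).
  rewrite YB subrKA [in LHS]/= -scalerBr; congr (_ *: _).
  by rewrite opprD addrACA subrr add0r.
rewrite hnormZr ger0_norm ?invr_ge0//.
have gS : 0 <= g n - g n.+1 by rewrite /= subKr divr_ge0// sqr_ge0.
have h1 : hnorm (Y n.+1 (Y n.+1 x - Y n x))
    <= (1 - g n.+1) * ((g n - g n.+1) * hnorm x).
  by apply: le_trans (Y_bounded _ _) _; rewrite ler_wpM2l// subr_ge0.
have h2 : hnorm (Y n.+1 (Y n x) - Y n (Y n x))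
    <= (g n - g n.+1) * ((1 - g n) * hnorm x).
  by apply: le_trans (IH _) _; rewrite ler_wpM2l// Y_bounded.
have := hnormD (Y n.+1 (Y n.+1 x - Y n x)) (Y n.+1 (Y n x) - Y n (Y n x)).
move: h1 h2; set a := hnorm (Y n.+1 _); set b := hnorm (_ - _).
set c := hnorm (_ + _); move=> h1 h2 h3.
have -> : g n.+1 - g n.+2 = g n.+1 ^+ 2 / 2 by rewrite /= subKr.
have e : g n - g n.+1 = g n ^+ 2 / 2 by rewrite /= subKr.
have : c <= (g n - g n.+1) * (2 - g n - g n.+1) * hnorm x by lra.
have -> : (g n - g n.+1) * (2 - g n - g n.+1) = g n.+1 ^+ 2.
  by rewrite /=; set d := g n; lra.
lra.
Qed.

Let limit_ex x : exists l, forall n, hnorm (l - Y n x) <= g n * hnorm x.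
Proof.
have [n|n|l lx] := @telescoping_limit _ _ _ (fun n => Y n x)
    (fun n => (1 - g n) * hnorm x) (hnorm x).
- by apply: le_trans (Y_step n x) _; lra.
- by rewrite ler_piMl ?hnorm_ge0// gerBl.
- by exists l => n; apply: le_trans (lx n) _; lra.
Qed.

Lemma sqrt_iter_limit : exists L : {linear V -> V},
  [/\ selfadjoint L, bounded_by L 1 & forall x, L x *+ 2 = T x + L (L x)].
Proof.
have [L LP] := choice limit_ex.
have L1 x : hnorm (L x) <= hnorm x.
  by have := LP x 0%N; rewrite /= subr0 mul1r.
have Llin : linear L.
  move=> a x y; apply/subr0_eq/hnorm_le0.
  apply: (@le0_of_sqrt_gap _ _
    (hnorm (a *: x + y) + res `|a| * hnorm x + hnorm y)).
    by rewrite !addr_ge0 ?mulr_ge0 ?hnorm_ge0 ?res_norm_ge0.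
  move=> n; apply: le_trans (hnorm_tri (Y n (a *: x + y)) _ _) _.
  have -> : Y n (a *: x + y) - (a *: L x + L y)
      = - (a *: (L x - Y n x) + (L y - Y n y)).
    by rewrite Y_linear scalerBr addrACA -opprD opprB.
  rewrite hnormN; have := hnormD (a *: (L x - Y n x)) (L y - Y n y).
  rewrite hnormZ; have := LP (a *: x + y) n; have := LP y n.
  have := ler_wpM2l (res_norm_ge0 a) (LP x n).
  move: (hnorm _) (hnorm _) (hnorm _) (hnorm _) => *; lra.
exists (lin_pack Llin); split=> [x y|x|x] /=.
- apply/subr0_eq/normr0_eq0; rewrite -[LHS]resK// -[RHS](rmorph0 ofreal).
  congr ofreal; apply: le_anti; rewrite res_norm_ge0 andbT.
  apply: (@le0_of_sqrt_gap _ _ (hnorm x * hnorm y *+ 2)).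
    by rewrite mulrn_wge0// mulr_ge0 ?hnorm_ge0.
  move=> n.
  have -> : dotp V (L x) y - dotp V x (L y)
      = dotp V (L x - Y n x) y - dotp V x (L y - Y n y).
    by rewrite dotpBl dotpBr Y_selfadjoint opprB addrA subrK.
  apply: le_trans (le_res (ler_normB _ _)) _; rewrite resD.
  have := res_norm_dotp (L x - Y n x) y.
  have := res_norm_dotp x (L y - Y n y).
  have := ler_wpM2r (hnorm_ge0 y) (LP x n).
  have := ler_wpM2l (hnorm_ge0 x) (LP y n).
  lra.
- by rewrite mul1r.
apply/subr0_eq/hnorm_le0.
apply: (@le0_of_sqrt_gap _ _ (hnorm x *+ 4)).
  by rewrite mulrn_wge0// hnorm_ge0.
move=> n.
have -> : L x *+ 2 - (T x + L (L x))
    = (L x - Y n.+1 x) *+ 2 - ((L (L x) - Y n (L x)) + Y n (L x - Y n x)).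
  have -> : (L x - Y n.+1 x) *+ 2 = L x *+ 2 - (T x + Y n (Y n x)).
    rewrite mulrnBl; congr (_ - _); rewrite /= scalerMnl -mulr_natl.
    by rewrite -(rmorph_nat ofreal) -rmorphM divff// rmorph1 scale1r.
  by rewrite YB addrA subrK !opprD !opprK -!addrA [- L (L x) + _]addrC addKr.
have h1 := LP x n.+1.
have h2 := LP (L x) n.
have h3 : hnorm (Y n (L x - Y n x)) <= g n * hnorm x.
  apply: le_trans (Y_bounded _ _) _; rewrite -[leRHS]mul1r.
  by rewrite ler_pM ?subr_ge0 ?hnorm_ge0// lerBlDr lerDl.
have h4 : g n * hnorm (L x) <= g n * hnorm x by rewrite ler_wpM2l.
have h5 : g n.+1 * hnorm x <= g n * hnorm x.
  by rewrite ler_wpM2r ?hnorm_ge0//= lerBlDr lerDl divr_ge0// sqr_ge0.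
apply: le_trans (hnormB _ _) _.
have := hnormD (L x - Y n.+1 x) (L x - Y n.+1 x); rewrite -mulr2n.
have := hnormD (L (L x) - Y n (L x)) (Y n (L x - Y n x)).
by move: h1 h2 h3 h4 h5 => /=; lra.
Qed.

End Contraction.

Lemma sqrt_contraction (A : {linear V -> V}) : positive_op A ->
  bounded_by A 1 -> exists B : {linear V -> V},
    [/\ bounded_by B 2, positive_op B & forall x, B (B x) = A x].
Proof.
move=> Apos A1.
have sA : selfadjoint A by case: Apos.
have Tlin : linear (fun x => x - A x).
  by move=> a x y; rewrite linearP opprD addrACA scalerBr.
have sT : selfadjoint (lin_pack Tlin).
  by move=> x y /=; rewrite dotpBl dotpBr sA.
have [L [sL L1 LP]] := sqrt_iter_limit sT (positive_contraction Apos A1).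
have Blin : linear (fun x => x - L x).
  by move=> a x y; rewrite linearP opprD addrACA scalerBr.
have sB : selfadjoint (lin_pack Blin).
  by move=> x y /=; rewrite dotpBl dotpBr sL.
exists (lin_pack Blin); split=> [x|| x] /=.
- by have := hnormB x (L x); have := L1 x; lra.
- apply/(positive_opP sB) => x /=; rewrite dotpBl resB -hnorm_sqr subr_ge0.
  apply: le_trans (res_dotp_le _ _) _; rewrite expr2 ler_wpM2r ?hnorm_ge0//.
  by have := L1 x; rewrite mul1r.
have := LP x; rewrite /= => LLx.
have : L (L x) = L x *+ 2 - (x - A x) by rewrite LLx addrC addKr.
rewrite [L (_ - _)]linearB => ->.
rewrite mulr2n [- (L x - _)]opprB -[L x + L x - _]addrA [L x + (_ - _)]addrC.
by rewrite addrK subrKA subKr.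
Qed.

Lemma opsqrtP (A : {linear V -> V}) : continuous A -> positive_op A ->
  [/\ continuous (opsqrt A), positive_op (opsqrt A)
    & forall x, opsqrt A (opsqrt A x) = A x].
Proof.
move=> /continuous_bounded_by[C C0 AC] Apos.
suff [Bc [Bpos BB]] : continuous (opsqrt A) /\
  (positive_op (opsqrt A) /\ forall x, opsqrt A (opsqrt A x) = A x) by [].
apply: (@the_boundedP _ _ _ _
  (fun B => positive_op B /\ forall x, B (B x) = A x)).
have sA : selfadjoint A by case: Apos.
have Slin c (F : {linear V -> V}) : linear (fun x => ofreal c *: F x).
  by move=> a x y; rewrite linearP scalerDr !scalerA mulrC.
have Spos c (F : {linear V -> V}) : 0 <= c -> positive_op F ->
    positive_op (lin_pack (Slin c F)).
  move=> c0 Fpos; have sF : selfadjoint F by case: Fpos.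
  apply/(positive_opP (selfadjointZ c sF)) => x /=.
  by rewrite dotpZl res_ofrealM mulr_ge0// positive_op_res.
(* rescale [A] to norm at most 1, and the root back by [sqrt C] *)
have [|x|B [B2 Bpos BB]] := @sqrt_contraction (lin_pack (Slin C^-1 A)).
- by apply: Spos => //; rewrite invr_ge0 ltW.
- rewrite /= hnormZr ger0_norm ?invr_ge0 ?(ltW C0)// mul1r.
  by rewrite ler_pdivrMl.
exists (lin_pack (Slin (Num.sqrt C) B)); split.
  apply: (@bounded_by_continuous _ _ _ _ _ (Num.sqrt C * 2)) => x /=.
  by rewrite hnormZr ger0_norm ?sqrtr_ge0// -mulrA ler_wpM2l ?sqrtr_ge0.
split; first by apply: Spos; rewrite ?sqrtr_ge0.
move=> x /=; rewrite linearZ BB /= !scalerA -!rmorphM -expr2.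
by rewrite sqr_sqrtr ?ltW// divff ?gt_eqF// rmorph1 scale1r.
Qed.

Lemma hnorm_opsqrt (A : {linear V -> V}) x : continuous A -> positive_op A ->
  hnorm (opsqrt A x) ^+ 2 = res (dotp V (A x) x).
Proof.
move=> Ac Apos; have [_ [sB _] BB] := opsqrtP Ac Apos.
by rewrite hnorm_sqr sB BB res_dotpC.
Qed.

End SquareRoot.

(** * Operator norms and inverses *)

Section BoundsOfOperators.
Variables (R : realType) (k : scalar_kind).

Lemma eq_ereal_of_ub (a b : \bar R) : (0 <= a)%E -> (0 <= b)%E ->
  (forall C : R, 0 <= C -> (a <= C%:E)%E <-> (b <= C%:E)%E) -> a = b.
Proof.
have half (x y : \bar R) : (0 <= y)%E ->
    (forall C : R, 0 <= C -> (y <= C%:E)%E -> (x <= C%:E)%E) -> (x <= y)%E.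
  by case: y => [r||] //= r0 xy; [apply: xy; rewrite -?lee_fin|rewrite leey].
move=> a0 b0 ab.
by apply/le_anti/andP; split; apply: half => // C C0 /(ab C C0).
Qed.

Lemma opnorm_ge0 (U V : hilbert R k) (A : U -> V) : (0 <= opnorm A)%E.
Proof.
apply: (@le_trans _ _ (hnorm (A 0))%:E); first by rewrite lee_fin hnorm_ge0.
by apply: ereal_sup_ubound; exists 0 => //=; rewrite hnorm0.
Qed.

Lemma opnorm_leP (U V : hilbert R k) (A : {linear U -> V}) C : 0 <= C ->
  (opnorm A <= C%:E)%E <-> bounded_by A C.
Proof.
move=> C0; split=> [AC x|AC].
  have [->|x0] := eqVneq x 0; first by rewrite linear0 !hnorm0 mulr0.
  have xn := hnorm_gt0 x0.
  have : ((hnorm (A (ofreal (hnorm x)^-1 *: x)))%:E <= C%:E)%E.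
    apply: le_trans AC; apply: ereal_sup_ubound.
    exists (ofreal (hnorm x)^-1 *: x) => //=.
    by rewrite hnormZr ger0_norm ?invr_ge0 ?(ltW xn)// mulVf ?gt_eqF.
  rewrite linearZ /= lee_fin hnormZr ger0_norm ?invr_ge0 ?(ltW xn)//.
  by rewrite ler_pdivrMl// mulrC.
apply: ge_ereal_sup => _ [x /= x1 <-]; rewrite lee_fin.
by apply: le_trans (AC x) _; rewrite ler_piMr.
Qed.

Lemma eq_on_clos_range (X Y Z : hilbert R k) (A : {linear X -> Y})
  (D D' : {linear subh (clos_range A) -> Z}) : continuous D -> continuous D' ->
  (forall x, D (to_clos_range A x) = D' (to_clos_range A x)) -> D =1 D'.
Proof.
move=> /continuous_bounded_by[C C0 DC] /continuous_bounded_by[C' C'0 DC'] DD' u.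
apply/subr0_eq/hnorm_le0; apply: (@le0_of_small _ _ (C + C')) => e e0.
have [x xu] := clos_range_dense u e0.
apply: le_trans (hnorm_tri (D (to_clos_range A x)) _ _) _.
rewrite [in X in _ + X]DD' -!linearB mulrDl lerD//.
  by apply: le_trans (DC _) _; rewrite ler_wpM2l ?ltW.
by apply: le_trans (DC' _) _; rewrite hnormC ler_wpM2l ?ltW.
Qed.

End BoundsOfOperators.

Section CoerciveInverse.
Variables (R : realType) (k : scalar_kind) (V : hilbert R k).
Variable S : {linear V -> V}.
Hypotheses (Sc : continuous S) (Spos : positive_op S).
Variable m : R.
Hypotheses (m0 : 0 < m).
Hypothesis Sm : forall x, m * hnorm x ^+ 2 <= res (dotp V (S x) x).

Let sS : selfadjoint S. Proof. by case: Spos. Qed.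

Let S_below x : hnorm x <= m^-1 * hnorm (S x).
Proof.
have [->|x0] := eqVneq x 0; first by rewrite linear0 hnorm0 mulr0.
rewrite ler_pdivlMl// -(ler_pM2r (hnorm_gt0 x0)) -mulrA -expr2.
exact: le_trans (Sm x) (res_dotp_le _ _).
Qed.

(* [|x| <= m^-1 |S x|] is the hypothesis of Douglas' lemma for the identity
   and [S], and [S] is its own adjoint: hence its range is everything *)
Let S_onto y : exists x, S x = y.
Proof.
have idP (x z : V) : dotp V (idfun x) z = dotp V x (id z) by [].
have [|x _ <-] := (douglas Sc idP).1 (ex_intro _ m^-1 S_below) y.
  by exists y.
exists x; apply: dotp_inj => z.
by rewrite sS [RHS]dotpC -(adjointP Sc).2 -dotpC.
Qed.

Lemma opinvP :
  [/\ continuous (opinv S), cancel S (opinv S) & cancel (opinv S) S].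
Proof.
suff [Ic [SK KS]] : continuous (opinv S) /\
  (cancel S (opinv S) /\ cancel (opinv S) S) by [].
apply: (@the_boundedP _ _ _ _ (fun B => cancel S B /\ cancel B S)).
have [I SI] := choice S_onto.
have Sinj x y : S x = S y -> x = y.
  move=> Sxy; apply/subr0_eq/hnorm_le0; apply: le_trans (S_below _) _.
  by rewrite linearB Sxy subrr hnorm0 mulr0.
have Ilin : linear I.
  by move=> a x y; apply: Sinj; rewrite linearP !SI.
exists (lin_pack Ilin); split; last by split=> x /=; [exact/Sinj/SI|].
by apply: (@bounded_by_continuous _ _ _ _ _ m^-1) => x /=; rewrite -{2}(SI x).
Qed.

Lemma opinv_positive : positive_op (opinv S).
Proof.
have [_ SK KS] := opinvP.
split=> [x y|x]; first by rewrite -{1}(KS y) -sS KS.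
by rewrite -{2}(KS x) -sS; case: Spos.
Qed.

(** For the square root [Q] of the inverse, [Q^2 = S^-1] gives [Q S Q = 1], as
    [Q] is injective.  Thus [<S u, u> = |g|^2] for [u = Q g], and every [u] has
    this form. *)
Lemma bounded_by_sqrt_opinv C : 0 <= C ->
  bounded_by (opsqrt (opinv S)) C <->
  forall u, hnorm u ^+ 2 <= C ^+ 2 * res (dotp V (S u) u).
Proof.
move=> C0; have [Ic SK KS] := opinvP.
have [] := opsqrtP Ic opinv_positive; set Q := opsqrt _ => Qc [sQ _] QQ.
have QSQ g : Q (S (Q g)) = g.
  have : Q (Q (Q (S (Q g)))) = Q (Q g) by rewrite [Q (Q (S _))]QQ SK.
  by rewrite !QQ => /(congr1 S); rewrite !KS.
have quad g : res (dotp V (S (Q g)) (Q g)) = hnorm g ^+ 2.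
  by rewrite -sQ QSQ -hnorm_sqr.
split=> [QC u|SC g].
  have -> : u = Q (Q (S u)) by rewrite QQ SK.
  rewrite quad -exprMn -hnorm_le_sqr ?mulr_ge0 ?hnorm_ge0//.
by rewrite hnorm_le_sqr ?mulr_ge0 ?hnorm_ge0// exprMn -(quad g); exact: SC.
Qed.

End CoerciveInverse.

(** * Observability, decoders and the minimax error *)

Section Setting.
Variables (R : realType) (k : scalar_kind) (X Y : hilbert R k).
Variables (O : {linear X -> Y}) (N : closed_subspace X).
Local Notation H := (Hsp N).
Local Notation ON := (@O_N _ _ _ _ O N).
Local Notation S := (@S_N _ _ _ _ O N).

HB.instance Definition _ := GRing.Linear.on (P_H N).

Lemma O_N_linear : linear ON.
Proof. by move=> a x y; rewrite /O_N !linearP. Qed.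
HB.instance Definition _ := GRing.isLinear.Build _ _ _ _ ON O_N_linear.

Lemma S_N_linear : linear S.
Proof. by move=> a x y; rewrite /S_N !linearP. Qed.
HB.instance Definition _ := GRing.isLinear.Build _ _ _ _ S S_N_linear.

Lemma P_H_val (h : H) : P_H N (val h) = h.
Proof. exact: proj_val. Qed.

Lemma P_H_eq0 n : cs_set N n -> P_H N n = 0.
Proof. by move=> Nn; rewrite /P_H proj_orthc coproj_eq0. Qed.

Lemma dotp_P_H x (h : H) : dotp H (P_H N x) h = dotp X x (val h).
Proof. exact: dotp_proj. Qed.

Lemma sub_P_H x : cs_set N (x - val (P_H N x)).
Proof.
rewrite /P_H proj_orthc /= subKr; exact/set_mem/valP.
Qed.

(** [x - P_H x] lies in [N], so [O] maps it into [Y_N]. *)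
Lemma O_N_P_H x : O_N O (P_H N x) = coproj (Y_N O N) (O x).
Proof.
apply/esym/subr0_eq; rewrite /O_N -!linearB /= coproj_eq0//.
by apply: subset_closure; exists (x - val (P_H N x)) => //; exact: sub_P_H.
Qed.

(** A bound by [|O x|] for all [x] applies to every [h - n] with [n] in [N], all
    of which have the same projection [h]; their images come arbitrarily close
    to [O_N h]. *)
Lemma bound_iff_O_N (Z : hilbert R k) (F : H -> Z) (C : R) : 0 <= C ->
  (forall x, hnorm (F (P_H N x)) <= C * hnorm (O x)) <->
  (forall h, hnorm (F h) <= C * hnorm (O_N O h)).
Proof.
move=> C0; split=> [FO h|FO x]; last first.
  apply: le_trans (FO _) _; rewrite ler_wpM2l// O_N_P_H.
  exact: hnorm_coproj_le.
rewrite -subr_le0; apply: (@le0_of_small _ _ C) => e e0.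
(* [O n] is chosen close to the projection of [O h] onto [Y_N] *)
have [_ [n Nn <-] yn] := closure_hnorm
  (set_mem (valP (proj (Y_N O N) (O (val h))))) e0.
have := FO (val h - n); rewrite !linearB /= P_H_val P_H_eq0// !subr0.
move=> Fh; rewrite lerBlDr -mulrDr; apply: le_trans Fh _; rewrite ler_wpM2l//.
apply: le_trans (hnorm_tri (val (proj (Y_N O N) (O (val h)))) _ _) _.
by rewrite addrC lerD2r ltW.
Qed.

Hypothesis Oc : continuous O.

Lemma O_N_continuous : continuous ON.
Proof.
have [C C0 OC] := continuous_bounded_by Oc.
apply: (@bounded_by_continuous _ _ _ _ _ C) => h.
by apply: le_trans (OC (val h)); exact: hnorm_coproj_le.
Qed.

Lemma S_N_continuous : continuous S.
Proof.
have [Ac _] := adjointP O_N_continuous.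
by move=> h; apply: continuous_comp; [exact: O_N_continuous|exact: Ac].
Qed.

Lemma dotp_S_N h h' : dotp H (S h) h' = dotp _ (ON h) (ON h').
Proof.
by rewrite dotpC -(adjointP O_N_continuous).2 -dotpC.
Qed.

Lemma S_N_selfadjoint : selfadjoint S.
Proof. by move=> h h'; rewrite dotp_S_N [RHS]dotpC dotp_S_N -dotpC. Qed.

Lemma res_dotp_S_N h : res (dotp H (S h) h) = hnorm (ON h) ^+ 2.
Proof. by rewrite dotp_S_N hnorm_sqr. Qed.

Lemma S_N_positive : positive_op S.
Proof.
apply/(positive_opP S_N_selfadjoint) => h.
by rewrite res_dotp_S_N sqr_ge0.
Qed.

Variable W : {linear H -> H}.
Hypotheses (Wc : continuous W) (Wpos : positive_op W).
Local Notation B := (opsqrt W).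

Lemma target_linear : linear (target W).
Proof. by move=> a x y; apply: val_inj; rewrite /= !linearP. Qed.
HB.instance Definition _ :=
  GRing.isLinear.Build _ _ _ _ (target W) target_linear.

Lemma hnorm_target x : hnorm (target W x) = hnorm (sqrtWP W x).
Proof. by []. Qed.

(** The constant is explicit because [kappa], the norm of the decoder and the
    minimax error are compared through the constants that satisfy this. *)
Definition observable (C : R) :=
  forall x, hnorm (sqrtWP W x) <= C * hnorm (O x).

Lemma observable_abs C : observable C -> observable `|C|.
Proof.
move=> OC x; apply: le_trans (OC x) _.
by rewrite ler_wpM2r ?hnorm_ge0 ?ler_norm.
Qed.

Lemma observable_O_N C : 0 <= C ->
  observable C <-> forall h, hnorm (B h) <= C * hnorm (ON h).
Proof. exact: (@bound_iff_O_N _ B). Qed.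

Lemma ex_observable_O_N : (exists C, observable C) <->
  exists C, forall h, hnorm (B h) <= C * hnorm (ON h).
Proof.
split=> [[C /observable_abs/observable_O_N OC]|[C OC]]; exists `|C|.
  exact: OC.
apply/observable_O_N => // h; apply: le_trans (OC h) _.
by rewrite ler_wpM2r ?hnorm_ge0 ?ler_norm.
Qed.

Lemma dominates_observable C :
  loewner_le W (fun h => ofreal (C ^+ 2) *: S h) <-> observable `|C|.
Proof.
have sW : selfadjoint W by case: Wpos.
rewrite observable_O_N//.
rewrite (loewner_leP sW (selfadjointZ (C ^+ 2) S_N_selfadjoint)).
have eqh h : (hnorm (B h) <= `|C| * hnorm (ON h)) =
    (res (dotp H (W h) h) <= res (dotp H (ofreal (C ^+ 2) *: S h) h)).
  rewrite hnorm_le_sqr ?mulr_ge0 ?hnorm_ge0// exprMn real_normK ?num_real//.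
  by rewrite (hnorm_opsqrt _ Wc Wpos) dotpZl res_ofrealM res_dotp_S_N.
by split=> WS h; move: (WS h); rewrite eqh.
Qed.

Lemma kappa_ge0 : (0 <= kappa O W)%E.
Proof.
by rewrite /kappa; case: ifP => // _; apply: ereal_sup_ubound; left.
Qed.

(** The kernel condition in [kappa] is implied by any such bound, so that the
    infinite value needs no separate treatment. *)
Lemma kappa_leP C : 0 <= C -> (kappa O W <= C%:E)%E <-> observable C.
Proof.
move=> C0; rewrite /kappa; split.
  case: ifPn => [/asboolP ker kC x|_]; last by rewrite leye_eq.
  have [Ox|Ox0] := eqVneq (O x) 0.
    by rewrite ker// Ox !hnorm0 mulr0.
  rewrite -ler_pdivrMr ?hnorm_gt0// -lee_fin; apply: le_trans kC.
  by apply: ereal_sup_ubound; right; exists x => //=; apply/eqP.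
move=> OC; rewrite ifT.
  apply: ge_ereal_sup => _ [->|[x /= /eqP Ox <-]]; first by rewrite lee_fin.
  by rewrite lee_fin ler_pdivrMr ?hnorm_gt0.
apply/asboolP => x Ox; apply: hnorm_le0.
by apply: le_trans (OC x) _; rewrite Ox hnorm0 mulr0.
Qed.

Lemma kappa_fin C : kappa O W = C%:E -> 0 <= C /\ observable C.
Proof.
move=> kC; have C0 : 0 <= C by rewrite -lee_fin -kC kappa_ge0.
by split=> //; apply/kappa_leP => //; rewrite kC.
Qed.

Lemma kappa_inf : kappa O W = ereal_inf [set C%:E | C in
  [set C : R | 0 <= C /\ loewner_le W (fun h => ofreal (C ^+ 2) *: S h)]].
Proof.
apply/le_anti/andP; split.
  apply: le_ereal_inf_tmp => _ [C /= [C0 /dominates_observable OC] <-].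
  by apply/kappa_leP => //; move: OC; rewrite ger0_norm.
case kE: (kappa O W) kappa_ge0 => [C||] //; last by move=> _; rewrite leey.
move=> _; have [C0 OC] := kappa_fin kE.
apply: ereal_inf_lbound; exists C => //=; split=> //.
by apply/dominates_observable; rewrite ger0_norm.
Qed.

Lemma decoder_ex C : 0 <= C -> observable C ->
  exists2 D : {linear subh (clos_range O) -> Qhat W},
    is_decoder D & bounded_by D C.
Proof.
move=> C0 OC; have [D [DO DC]] := @extension _ _ _ _ _ O (target W) C C0 OC.
by exists D => //; split=> //; exact: bounded_by_continuous DC.
Qed.

Lemma decoder_unique (D D' : {linear subh (clos_range O) -> Qhat W}) :
  is_decoder D -> is_decoder D' -> D' =1 D.
Proof.
move=> [Dc DO] [D'c D'O]; apply: eq_on_clos_range => // x.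
by rewrite DO D'O.
Qed.

Lemma decoder_bound (D : {linear subh (clos_range O) -> Qhat W}) C :
  0 <= C -> is_decoder D -> bounded_by D C <-> observable C.
Proof.
move=> C0 Ddec; split=> [DC x|/(decoder_ex C0)[D' D'dec D'C] u].
  by rewrite -hnorm_target -Ddec.2; exact: DC.
by rewrite -(decoder_unique Ddec D'dec).
Qed.

Lemma kappa_opnorm (D : {linear subh (clos_range O) -> Qhat W}) :
  is_decoder D -> kappa O W = opnorm D.
Proof.
move=> Ddec; apply: eq_ereal_of_ub => [||C C0].
- exact: kappa_ge0.
- exact: opnorm_ge0.
by rewrite (kappa_leP C0) (opnorm_leP D C0) (decoder_bound C0 Ddec).
Qed.

Variables (delta : R) (delta0 : 0 < delta).

(** [0 = O x + (- O x) = O (- x) + O x]: the measurement 0 may come from [x] or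
    from [- x], whose targets are at distance [2 |target x|]. *)
Lemma worst_error_ge_target (Dh : Y -> Qhat W) x : hnorm (O x) <= delta ->
  ((hnorm (target W x))%:E <= worst_error O delta Dh)%E.
Proof.
move=> Ox.
have err z e : hnorm e <= delta -> O z + e = 0 ->
    ((hnorm (Dh 0 - target W z))%:E <= worst_error O delta Dh)%E.
  by move=> ed ze; apply: ereal_sup_ubound; exists (z, e) => //=; rewrite ze.
have := err (- x) (O x) Ox; have := err x (- O x).
rewrite hnormN subrr !linearN addNr opprK => /(_ Ox erefl) + /(_ erefl).
case: (worst_error O delta Dh) => [E||] //; last by move=> *; rewrite leey.
rewrite !lee_fin => e1 e2.
have := hnormB (Dh 0 + target W x) (Dh 0 - target W x).
have -> : Dh 0 + target W x - (Dh 0 - target W x) = target W x *+ 2.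
  by rewrite opprB [Dh 0 + _]addrC addrA addrAC addrK mulr2n.
by rewrite hnormM2; lra.
Qed.

Lemma worst_error_ge (Dh : Y -> Qhat W) :
  (delta%:E * kappa O W <= worst_error O delta Dh)%E.
Proof.
have T0 : (0 <= worst_error O delta Dh)%E.
  have := @worst_error_ge_target Dh 0; rewrite !linear0 !hnorm0.
  by apply; exact: ltW.
case EE : (worst_error O delta Dh) T0 => [E||] //; last first.
  by move=> _; rewrite leey.
rewrite lee_fin => E0.
(* by homogeneity, the bound reaches all [x]: take [t = delta / |O x|], and
   arbitrarily large [t] when [O x = 0] *)
have scaled x t : 0 < t -> t * hnorm (O x) <= delta ->
    t * hnorm (target W x) <= E.
  move=> t0 tx; rewrite -lee_fin -EE.
  have := @worst_error_ge_target Dh (ofreal t *: x).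
  by rewrite !linearZ /= !hnormZr gtr0_norm//; apply.
have /kappa_leP kE : 0 <= E / delta by rewrite divr_ge0// ltW.
have /kE : observable (E / delta).
  move=> x; rewrite -hnorm_target.
  have [Ox|Ox0] := eqVneq (O x) 0.
    rewrite Ox hnorm0 mulr0; apply: (@le0_of_small _ _ E) => e e0.
    have := scaled x e^-1; rewrite Ox hnorm0 mulr0 invr_gt0.
    move=> /(_ e0 (ltW delta0)).
    by rewrite ler_pdivrMl// mulrC.
  have On := hnorm_gt0 Ox0.
  have := scaled x (delta / hnorm (O x)); rewrite divr_gt0// divfK ?gt_eqF//.
  move=> /(_ isT (lexx _)); rewrite mulrAC ler_pdivrMr// -ler_pdivlMl//.
  by rewrite mulrA [delta^-1 * _]mulrC.
move=> kap.
apply: (@le_trans _ _ (delta%:E * (E / delta)%:E)%E).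
  by rewrite lee_wpmul2l// lee_fin ltW.
by rewrite -EFinM lee_fin mulrC divfK ?gt_eqF.
Qed.

(** The decoder applied after the projection onto the closed range of [O]
    reproduces the target up to the image of the projected noise. *)
Lemma minimax_le C : kappa O W = C%:E ->
  (minimax_error O W delta <= (delta * C)%:E)%E.
Proof.
move=> /kappa_fin[C0 OC]; have [D [Dc DO] DC] := decoder_ex C0 OC.
pose Dh y := D (proj (clos_range O) y).
apply: (@le_trans _ _ (worst_error O delta Dh)).
  by apply: ereal_inf_lbound; exists Dh.
apply: ge_ereal_sup => _ [[x e] /= ed <-]; rewrite lee_fin /Dh.
rewrite [proj _ _]linearD [D _]linearD /=.
have -> : proj (clos_range O) (O x) = to_clos_range O x.
  exact: (proj_val (to_clos_range O x)).
rewrite DO addrC addKr mulrC; apply: le_trans (DC _) _; rewrite ler_wpM2l//.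
exact: le_trans (hnorm_proj_le _ _) ed.
Qed.

Lemma minimax_kappa : minimax_error O W delta = (delta%:E * kappa O W)%E.
Proof.
apply/le_anti/andP; split; last first.
  by apply: le_ereal_inf_tmp => _ [Dh _ <-]; exact: worst_error_ge.
case kE: (kappa O W) (kappa_ge0) => [C||]// _; first exact: minimax_le.
by rewrite gt0_muley ?leey// lte_fin.
Qed.

End Setting.

Theorem theorem2p5 (R : realType) (k : scalar_kind) (X Y : hilbert R k)
    (O : {linear X -> Y}) (O_bounded : continuous O)
    (N : closed_subspace X)
    (W : {linear Hsp N -> Hsp N}) (W_bounded : continuous W)
    (W_positive : positive_op W) :
  let cond_i := exists C : R, forall x : X,
    hnorm (sqrtWP W x) <= C * hnorm (O x) in
  let dominates (C : R) :=
    loewner_le W (fun h => ofreal (C ^+ 2) *: S_N O h) in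
  let cond_ii := exists C : R, dominates C in
  let cond_iii := range (opsqrt W) `<=` range (adjoint (@O_N _ _ _ _ O N)) in
  let cond_iv := exists2 D : {linear subh (clos_range O) -> Qhat W},
    is_decoder D & forall D' : {linear subh (clos_range O) -> Qhat W},
      is_decoder D' -> D' =1 D in
  [/\ [/\ cond_i <-> cond_ii, cond_i <-> cond_iii & cond_i <-> cond_iv],
      cond_i ->
        kappa O W = ereal_inf [set C%:E | C in [set C : R | 0 <= C /\ dominates C]]
        /\ forall D : {linear subh (clos_range O) -> Qhat W},
             is_decoder D -> kappa O W = opnorm D,
      forall delta : R, 0 < delta ->
        minimax_error O W delta = (delta%:E * kappa O W)%E
        /\ ((forall h, W h = 0) ->
            minimax_error O W delta = 0%E /\ (delta%:E * kappa O W)%E = 0%E)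
    & (forall h, W h = h) -> (exists h : Hsp N, h != 0) ->
        [/\ cond_i <-> exists2 m : R, 0 < m &
                loewner_le (fun h => ofreal (m ^+ 2) *: h) (@S_N _ _ _ _ O N),
            cond_i <-> (cs_set (orthc N) `<=` range (adjoint O))
          & cond_i -> kappa O W = opnorm (opsqrt (opinv (@S_N _ _ _ _ O N)))]].
Proof.
move=> cond_i dominates cond_ii cond_iii cond_iv.
have [Bc [sB _] _] := opsqrtP W_bounded W_positive.
have Oc := O_N_continuous (N := N) O_bounded.
split.
- split.
  + split=> [[C /observable_abs OC]|[C domC]].
      by exists C; apply/(dominates_observable O_bounded W_bounded W_positive).
    by exists `|C|; apply/(dominates_observable O_bounded W_bounded W_positive).
  + by apply: iff_trans (ex_observable_O_N O W) _; exact: douglas Oc sB.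
  + split=> [[C /observable_abs/(decoder_ex (normr_ge0 C))[D Ddec _]]|].
      by exists D => // D' /(decoder_unique Ddec).
    move=> [D Ddec _]; have [C C0 DC] := continuous_bounded_by Ddec.1.
    by exists C; apply/(decoder_bound (ltW C0) Ddec).
- move=> _; split; first exact: kappa_inf.
  by move=> D; exact: kappa_opnorm.
- move=> delta delta0; have eqmk := minimax_kappa O W delta0.
  split=> // W0; have k0 : kappa O W = 0%E.
    apply/le_anti; rewrite kappa_ge0 andbT; apply/kappa_leP => // x.
    rewrite mul0r hnorm_le_sqr// expr0n /=.
    rewrite (hnorm_opsqrt _ W_bounded W_positive).
    by rewrite W0 dotp0l raddf0.
  by rewrite eqmk k0 mule0.
move=> WI _.
have normB h : hnorm (opsqrt W h) = hnorm h.
  apply/eqP; rewrite -(eqrXn2 (n := 2)) ?hnorm_ge0//.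
  by rewrite (hnorm_opsqrt _ W_bounded W_positive) WI hnorm_sqr.
have coercive_iff m : 0 <= m ->
    loewner_le (fun h => ofreal m *: h) (@S_N _ _ _ _ O N) <->
    forall h, m * hnorm h ^+ 2 <= res (dotp (Hsp N) (S_N O h) h).
  move=> m0; rewrite loewner_leP; last exact: S_N_selfadjoint.
    by split=> mS h; move: (mS h); rewrite dotpZl res_ofrealM -hnorm_sqr.
  exact: (@selfadjointZ _ _ _ m id).
have coercive : cond_i -> exists2 m : R, 0 < m &
    forall h, m ^+ 2 * hnorm h ^+ 2 <= res (dotp (Hsp N) (S_N O h) h).
  move=> [C /observable_abs/(observable_O_N _ _ (normr_ge0 C)) OC].
  have C1 : 0 < `|C| + 1 by rewrite ltr_wpDl.
  (* [C] may be 0 here, hence the shift by 1 *)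
  exists (`|C| + 1)^-1; first by rewrite invr_gt0.
  move=> h; rewrite (res_dotp_S_N O_bounded) -exprMn.
  rewrite ler_pXn2r ?nnegrE ?mulr_ge0 ?invr_ge0 ?hnorm_ge0 ?(ltW C1)//.
  rewrite ler_pdivrMl// -normB; apply: le_trans (OC h) _.
  by rewrite ler_wpM2r ?hnorm_ge0// lerDl.
split.
- split=> [/coercive[m m0 mS]|[m m0 mS]].
    by exists m => //; apply/coercive_iff => //; rewrite exprn_ge0// ltW.
  apply/ex_observable_O_N; exists m^-1 => h; rewrite normB ler_pdivlMl//.
  move/coercive_iff : mS => /(_ (exprn_ge0 _ (ltW m0)) h).
  rewrite (res_dotp_S_N O_bounded) -exprMn.
  by rewrite ler_pXn2r ?nnegrE ?mulr_ge0 ?hnorm_ge0 ?(ltW m0).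
- have -> : cs_set (orthc N) = range (fun h : Hsp N => val h).
    apply/seteqP; split=> [x Hx|_ [h _ <-]]; last exact/set_mem/valP.
    by exists (SubH (mem_set Hx)).
  rewrite -(douglas O_bounded (@dotp_P_H _ _ _ N)).
  by split=> -[C OC]; exists C => x; move: (OC x); rewrite /sqrtWP normB.
move=> /coercive[m m0 mS]; have m20 : 0 < m ^+ 2 by rewrite exprn_gt0.
have Sc := S_N_continuous (N := N) O_bounded.
have Spos := S_N_positive N O_bounded.
apply: eq_ereal_of_ub => [||C C0]; [exact: kappa_ge0|exact: opnorm_ge0|].
rewrite (kappa_leP _ _ C0) (opnorm_leP _ C0).
rewrite (bounded_by_sqrt_opinv Sc Spos m20 mS C0) (observable_O_N _ _ C0).
split=> OC h; move: (OC h).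
  rewrite normB (res_dotp_S_N O_bounded) -exprMn.
  by rewrite hnorm_le_sqr ?mulr_ge0 ?hnorm_ge0.
rewrite normB (res_dotp_S_N O_bounded) -exprMn.
by rewrite [in X in _ -> X]hnorm_le_sqr ?mulr_ge0 ?hnorm_ge0.
Qed.
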